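(* Let $G$ be a countable directed graph. Then the finite dimensional irreducible representations of the free semigroupoid algebra $\mathfrak{L}_G$ separate points (that is, for every non-zero $A\in\mathfrak{L}_G$ there is a finite dimensional irreducible representation $\phi$ of $\mathfrak{L}_G$ with $\phi(A)\neq 0$) if and only if $G$ is transitive in each component.
   Context: A countable directed graph $G=(\mathcal V(G),\mathcal E(G),r,s)$ consists of a countable set $\mathcal V(G)$ of vertices, a countable set $\mathcal E(G)$ of edges, and range and source maps $r,s:\mathcal E(G)\to\mathcal V(G)$. A path is a finite sequence of edges $p=e_k\cdots e_2e_1$ with $r(e_i)=s(e_{i+1})$ for $1\le i<k$; its length is $|p|=k$, $s(p)=s(e_1)$, $r(p)=r(e_k)$. Each vertex $x$ is a path of length $0$ with $s(x)=r(x)=x$. $\mathbb F^+(G)$ is the set of all paths (including vertices); the product $pq$ is defined when $r(q)=s(p)$. Let $\mathcal H_G=\ell^2(\mathbb F^+(G))$ with orthonormal basis $\{\xi_w:w\in\mathbb F^+(G)\}$. For $p\in\mathbb F^+(G)$ let $L_p\xi_w=\xi_{pw}$ if $s(p)=r(w)$ and $L_p\xi_w=0$ otherwise. The free semigroupoid algebra $\mathfrak L_G$ is the algebra generated by $\{L_p:p\in\mathbb F^+(G)\}$, closed in the weak operator topology (WOT). A representation of $\mathfrak L_G$ is a norm-continuous algebra homomorphism into $\mathcal B(\mathcal H)$ for a Hilbert space $\mathcal H$. It is irreducible if its range is WOT-dense in $\mathcal B(\mathcal H)$ (when $\mathcal H$ is finite dimensional: if it maps onto $\mathcal B(\mathcal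 H)$). $G$ is transitive if there is a path from each vertex to every other vertex. $G$ is connected if the undirected graph determined by $G$ is connected; a connected component is a maximal connected subgraph. $G$ is transitive in each component if each connected component of $G$ is transitive. *)

(* Defs.v *)
From HB Require Import structures.
From mathcomp Require Import all_boot all_order all_algebra finmap.
From mathcomp Require Import complex ring lra.
From mathcomp Require Import all_classical all_reals all_analysis.
From mathcomp Require Import summability.

Set Implicit Arguments.
Unset Strict Implicit.
Unset Printing Implicit Defensive.

Import Order.TTheory GRing.Theory Num.Theory.
Import numFieldNormedType.Exports.

Local Open Scope classical_set_scope.
Local Open Scope ring_scope.

(* The complex numbers as an abstract numClosedFieldType: the topology of the
   analysis library is keyed on such structures, and is not found on the bare
   type [R[i]]. *)
Definition C (R : realType) : numClosedFieldType := R[i]%C.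

(* Real-valued modulus; the library norm [`|z|] is valued in [C R]. *)
Definition cabs (R : realType) (z : C R) : R := Normc.normc z.

Section cabs.
Variable R : realType.
Implicit Types a z w : C R.

Lemma cabs_ge0 z : 0 <= cabs z.
Proof. by case: z => a b; exact: sqrtr_ge0. Qed.

Lemma cabs0 : cabs (0 : C R) = 0.
Proof. exact: Normc.normc0. Qed.

Lemma cabs_sqr_lin a z w :
  cabs (a * z + w) ^+ 2 <= (2 * cabs a ^+ 2) * cabs z ^+ 2 + 2 * cabs w ^+ 2.
Proof.
have h : cabs (a * z + w) <= cabs a * cabs z + cabs w.
  by rewrite /cabs -Normc.normcM; exact: le_normcD.
apply: (le_trans (y := (cabs a * cabs z + cabs w) ^+ 2)).
  by rewrite lerXn2r ?nnegrE ?addr_ge0 ?mulr_ge0 ?cabs_ge0.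
have := sqr_ge0 (cabs a * cabs z - cabs w); rewrite !expr2; lra.
Qed.

End cabs.

Section l2.
Variables (R : realType) (I : choiceType).

Definition sqnorm (f : I -> C R) : \bar R :=
  (\esum_(i in [set: I]) (cabs (f i) ^+ 2)%:E)%E.

Definition l2_pred : {pred I -> C R} := fun f => `[< (sqnorm f < +oo)%E >].

Lemma sqnorm_ge0 (f : I -> C R) : (0 <= sqnorm f)%E.
Proof. by apply: esum_ge0 => i _; rewrite lee_fin sqr_ge0. Qed.

Lemma sqnorm_lin (a : C R) (f g : I -> C R) :
  (sqnorm (a *: f + g)%R
    <= (2 * cabs a ^+ 2)%:E * sqnorm f + 2%:E * sqnorm g)%E.
Proof.
apply: ge_ereal_sup => _ /= [X [finX XI]] <-.
have scale c (h : I -> C R) : 0 <= c ->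
    (\sum_(i \in X) (c * cabs (h i) ^+ 2)%:E <= c%:E * sqnorm h)%E.
  move=> c0; under eq_fsbigr do rewrite EFinM.
  rewrite -ge0_mule_fsumr; last by move=> i; rewrite lee_fin sqr_ge0.
  by apply: lee_wpmul2l; rewrite ?lee_fin//; apply: esum_ge; exists X.
have ca0 : 0 <= 2 * cabs a ^+ 2 by rewrite mulr_ge0 ?sqr_ge0.
apply: le_trans (leeD (scale _ f ca0) (scale 2 g (ler0n _ _))).
rewrite -fsbig_split//=; apply: lee_fsum => // i _.
by rewrite -EFinD lee_fin; exact: cabs_sqr_lin.
Qed.

Lemma l2_submod_closed : submod_closed l2_pred.
Proof.
split=> [|a f g /asboolP fI /asboolP gI]; apply/asboolP.
  by rewrite /sqnorm esum1// => i _; rewrite cabs0 expr0n.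
apply: le_lt_trans (sqnorm_lin a f g) _.
by rewrite lte_add_pinfty// lte_mul_pinfty// lee_fin mulr_ge0 ?sqr_ge0.
Qed.

HB.instance Definition _ :=
  GRing.isSubmodClosed.Build (C R) (I -> C R) l2_pred l2_submod_closed.

Record l2 := L2 { l2_fun :> I -> C R; l2P : l2_fun \in l2_pred }.

HB.instance Definition _ := [isSub for l2_fun].
HB.instance Definition _ := [Choice of l2 by <:].
HB.instance Definition _ := [SubChoice_isSubLmodule of l2 by <:].

End l2.

Section operators.
Variables (R : realType) (I : choiceType).
Implicit Types (x y : l2 R I).

Definition l2norm x : R := Num.sqrt (fine (sqnorm x)).

(* The sum is unconditional, i.e. the limit along the finite subsets of [I]. *)
Definition l2dot x y : C R := sum (fun i => x i * (y i)^*).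

Fact l2_delta_subproof (i : I) : (fun j => (j == i)%:R : C R) \in @l2_pred R I.
Proof.
apply/asboolP; rewrite /sqnorm (esumID [set i])//=; last first.
  by move=> j _; rewrite lee_fin sqr_ge0.
rewrite !setTI esum_set1 ?lee_fin ?sqr_ge0// esum1 ?adde0 ?ltry// => j /eqP.
by move=> /negbTE ->; rewrite cabs0 expr0n.
Qed.

Definition l2_delta (i : I) : l2 R I := L2 (l2_delta_subproof i).

Definition op := l2 R I -> l2 R I.

(* The elements of B(H) are the [T : op] such that [bounded_op T]. *)
Definition bounded_op (T : op) : Prop :=
  linear T /\ exists c : R, forall x, l2norm (T x) <= c * l2norm x.

Definition opnorm (T : op) : R :=
  sup [set l2norm (T x) | x in [set x | l2norm x <= 1]].

Definition wot_coef (T : op) : prod_topology (fun _ : l2 R I * l2 R I => C R) :=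
  fun xy => l2dot (T xy.1) xy.2.

(* The weak operator topology: the coarsest topology making every
   [T |-> <T x, y>] continuous. *)
Definition wot := initial_topology wot_coef.

(* Closure in B(H), which carries the subspace topology of [wot]. *)
Definition wot_closure (S : set op) : set op :=
  [set T | bounded_op T /\ closure (S : set wot) T].

Definition is_subalgebra (S : set op) : Prop :=
  [/\ S 0,
      forall (a : C R) (A B : op), S A -> S B -> S (a *: A + B)
    & forall A B : op, S A -> S B -> S (A \o B)].

Definition generated_algebra (S : set op) : set op := smallest is_subalgebra S.

End operators.

Record digraph := Digraph {
  vertex : countType;
  edge : countType;
  src : edge -> vertex;
  rng : edge -> vertex }.

Section paths.
Variable G : digraph.

(* A path e_k ... e_1 is coded as its source paired with the edges in the order
   in which they are travelled, [:: e_1; ...; e_k]; the paths of length 0 are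
   the [(x, [::])]. *)
Definition wf_dpath (p : vertex G * seq (edge G)) : bool :=
  if p.2 is e :: es then
    (src e == p.1) && path (fun e1 e2 => rng e1 == src e2) e es
  else true.

Record dpath := DPath {
  dpath_val :> vertex G * seq (edge G);
  dpathP : wf_dpath dpath_val }.

HB.instance Definition _ := [isSub for dpath_val].
HB.instance Definition _ := [Countable of dpath by <:].

Definition psrc (p : dpath) : vertex G := p.1.
Definition pedges (p : dpath) : seq (edge G) := p.2.
Definition prng (p : dpath) : vertex G := last p.1 (map (@rng G) p.2).

Lemma wf_dpath_cat (q p : dpath) :
  prng q = psrc p -> wf_dpath (psrc q, pedges q ++ pedges p).
Proof.
case: q p => [[x es] /= wq] [[y fs] /= wp]; rewrite /prng /psrc /pedges /=.
case: es wq => [|e es] /=; first by move=> _ ->; exact: wp.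
rewrite /wf_dpath/= cat_path => /andP[-> ->] /=; rewrite last_map => lasty.
by case: fs wp => //= f fs /andP[/eqP-> ->]; rewrite lasty eqxx.
Qed.

(* [pcomp p q] is the product pq (first q, then p), where defined. *)
Definition pcomp (p q : dpath) : option dpath :=
  if prng q =P psrc p is ReflectT h then Some (DPath (wf_dpath_cat h)) else None.

End paths.

Section free_semigroupoid_algebra.
Variables (R : realType) (G : digraph).

Let H := l2 R (dpath G).

(* Uniqueness of [w] in [u = pw] makes this the operator sending the basis
   vector xi_w to xi_{pw}, or to 0 if pw is undefined: see [Lop_delta]. *)
Definition Lop_fun (p : dpath G) (f : H) (u : dpath G) : C R :=
  if pselect (exists w, pcomp p w = Some u) is left h
  then f (projT1 (cid h)) else 0.

Lemma pcomp_inj (p w w' u : dpath G) :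
  pcomp p w = Some u -> pcomp p w' = Some u -> w = w'.
Proof.
rewrite /pcomp; case: eqP => // h [<-]; case: eqP => // h' [].
rewrite /psrc /pedges => esrc /(congr1 rev); rewrite !rev_cat => /eqP.
rewrite eqseq_cat// eqxx/= => /eqP/(can_inj revK) eedges; apply: val_inj => /=.
by rewrite [LHS]surjective_pairing [RHS]surjective_pairing esrc eedges.
Qed.

Lemma Lop_funE p (f : H) w u : pcomp p w = Some u -> Lop_fun p f u = f w.
Proof.
move=> pwu; rewrite /Lop_fun; case: pselect => [h|[]]; last by exists w.
by case: cid => w' /= pwu'; rewrite (pcomp_inj pwu' pwu).
Qed.

Lemma Lop_fun0 p (f : H) u :
  (forall w, pcomp p w <> Some u) -> Lop_fun p f u = 0.
Proof.
by move=> nu; rewrite /Lop_fun; case: pselect => // h; have [w /nu] := h.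
Qed.

Lemma sqnorm_Lop_fun p (f : H) : (sqnorm (Lop_fun p f) <= sqnorm f)%E.
Proof.
pose D := [set w | prng w = psrc p].
pose m w := odflt w (pcomp p w).
have mD w : D w -> pcomp p w = Some (m w).
  by rewrite /m /pcomp /D /=; case: eqP.
have minj : set_inj D m.
  move=> w w' /set_mem /mD pw /set_mem /mD pw' e.
  by apply: pcomp_inj pw _; rewrite e.
rewrite /sqnorm (esumID (m @` D))//; last by move=> u _; rewrite lee_fin sqr_ge0.
rewrite !setTI [X in (_ + X)%E]esum1 ?adde0; last first.
  move=> u nu; rewrite Lop_fun0 ?cabs0 ?expr0n// => w pw; apply: nu.
  have Dw : D w by move: pw; rewrite /pcomp /D/=; case: eqP.
  by exists w => //; rewrite /m pw.
rewrite esum_image//.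
under eq_esum => w Dw do rewrite (Lop_funE _ (mD _ Dw)).
rewrite [leRHS](esumID D)// ?setTI; last by move=> w _; rewrite lee_fin sqr_ge0.
by rewrite leeDl// esum_ge0// => w _; rewrite lee_fin sqr_ge0.
Qed.

Fact Lop_subproof p (f : H) : Lop_fun p f \in @l2_pred R (dpath G).
Proof.
apply/asboolP; apply: le_lt_trans (sqnorm_Lop_fun p f) _.
exact/asboolP/(l2P f).
Qed.

Definition Lop (p : dpath G) : op R (dpath G) := fun f => L2 (Lop_subproof p f).

Lemma Lop_delta p w :
  Lop p (l2_delta R w) = if pcomp p w is Some u then l2_delta R u else 0.
Proof.
apply: val_inj; apply/funext => u /=.
have [[w' pw']|nu] := pselect (exists w', pcomp p w' = Some u).
  rewrite (Lop_funE _ pw') /=; case: eqP => [<-|nw]; first by rewrite pw' /= eqxx.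
  case pw : (pcomp p w) => [v|] //=; case: eqP => // uv.
  by case: nw; apply: pcomp_inj pw' _; rewrite uv.
rewrite Lop_fun0 => [|w' pw']; last by apply: nu; exists w'.
case pw : (pcomp p w) => [v|] //=; case: eqP => // uv.
by case: nu; exists w; rewrite uv.
Qed.

Lemma Lop_bounded p : bounded_op (Lop p).
Proof.
split=> [a f g|].
  apply: val_inj; apply/funext => u.
  rewrite -[LHS]/(Lop_fun p (a *: f + g) u).
  rewrite -[RHS]/(a * Lop_fun p f u + Lop_fun p g u).
  have [[w pw]|nu] := pselect (exists w, pcomp p w = Some u).
    by rewrite !(Lop_funE _ pw).
  by rewrite !Lop_fun0 ?mulr0 ?addr0// => w pw; apply: nu; exists w.
exists 1 => f; rewrite mul1r ler_wsqrtr// fine_le//; last exact: sqnorm_Lop_fun.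
  by rewrite ge0_fin_numE ?sqnorm_ge0//; exact/asboolP/(l2P (Lop p f)).
by rewrite ge0_fin_numE ?sqnorm_ge0//; exact/asboolP/(l2P f).
Qed.

Definition free_semigroupoid_algebra : set (op R (dpath G)) :=
  wot_closure (generated_algebra (range Lop)).

(* Representations on C^n, with B(C^n) identified with the n x n matrices. Only
   the values of [phi] on the algebra matter. Continuity is from the operator
   norm to the norm topology of the matrix space. *)
Definition is_representation n (phi : op R (dpath G) -> 'M[C R]_n) : Prop :=
  let LG := free_semigroupoid_algebra in
  [/\ forall (a : C R) A B, LG A -> LG B -> phi (a *: A + B) = a *: phi A + phi B,
      forall A B, LG A -> LG B -> phi (A \o B) = phi A *m phi B
    & forall A, LG A -> forall U, nbhs (phi A) U ->
        exists2 d : R, 0 < d &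
          forall B, LG B -> opnorm (B - A) < d -> U (phi B)].

Definition is_irreducible n (phi : op R (dpath G) -> 'M[C R]_n) : Prop :=
  phi @` free_semigroupoid_algebra = [set: 'M[C R]_n].

End free_semigroupoid_algebra.

Section components.
Variable G : digraph.
Implicit Types (W : set (vertex G)) (D : set (edge G)).

Definition is_subgraph W D : Prop := forall e, D e -> W (src e) /\ W (rng e).

Definition is_connected W D : Prop := forall x y, W x -> W y ->
  Relation_Operators.clos_refl_sym_trans _
    (fun a b => exists2 e, D e & src e = a /\ rng e = b) x y.

Definition is_transitive W D : Prop := forall x y, W x -> W y ->
  exists p : dpath G,
    [/\ psrc p = x, prng p = y & forall e, e \in pedges p -> D e].

Definition is_component W D : Prop :=
  [/\ is_subgraph W D, is_connected W D
    & forall W' D', is_subgraph W' D' -> is_connected W' D' ->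
        W `<=` W' -> D `<=` D' -> W' = W /\ D' = D].

Definition transitive_in_each_component : Prop :=
  forall W D, is_component W D -> is_transitive W D.

End components.

(* Main.v *)
From mathcomp Require Import all_boot all_order all_algebra finmap.
From mathcomp Require Import complex ring lra zify.
From mathcomp Require Import all_classical all_reals all_analysis.
From mathcomp Require Import summability.
Require Import Defs.

Set Implicit Arguments.
Unset Strict Implicit.
Unset Printing Implicit Defensive.

Import Order.TTheory GRing.Theory Num.Theory.
Import numFieldNormedType.Exports.

Local Open Scope classical_set_scope.
Local Open Scope ring_scope.

(** Necessity. Suppose that no path leads from the range of an edge [e] back to
    its source. Then [L_e A L_e = 0] for every [A] in the algebra: the vectors
    carried by the paths that end at a vertex reachable from the range of [e] form
    an invariant subspace, which contains the range of [L_e] and is killed by [L_e]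
    ([LG_reachable], [Lop_edge_sandwich]). A representation [phi] onto the [n] by
    [n] matrices thus satisfies [phi(L_e) M phi(L_e) = 0] for every matrix [M], and
    kills the nonzero operator [L_e]. So if these representations separate points,
    then every edge can be undone by a path, and each connected component is
    transitive ([transitive_of_edges]).

    Sufficiency. Representations come from finite-dimensional subspaces that are
    invariant under the adjoints of the [L_p]. Let the [y_k] span such a subspace
    and let the [x_k] be dual to them. The identity
    [<T z, y_i> = sum_k <T x_k, y_i> <z, y_k>] holds for the generators, passes to
    products and to linear combinations, and is weakly continuous in [T]. It
    therefore holds on the whole algebra ([coinvariant_LG]), where it says that
    [T |-> (<T x_j, y_i>)_ij] is multiplicative. Norm continuity is the
    Cauchy-Schwarz inequality.

    A nonzero [A] has a nonzero Fourier coefficient [a_p = <A xi_s(p), xi_p>]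
    ([LG_coef_neq0]): the matrix of [A] is lower triangular for the order of initial
    segments, and commutes with right translations. If [p] is a vertex, then
    [A |-> a_p] is itself multiplicative ([vertex_separates]). Otherwise
    transitivity completes [p] to a cycle [c]. Call the distinct rotations of [c]
    states, and for [0 < t <= 1/2] let [y_k] be the sum over [n] of
    [t^n xi_(w_(k, n))], where [w_(k, n)] is the walk of length [n] along [c] that
    ends in the state [k]. The adjoint of [L_p] maps [y_k] to a multiple of some
    [y_l] or to [0] ([l2dot_Lop_walk]), so these vectors span a coinvariant
    subspace. A walk of length [|c|] spells out its final state, which yields the
    dual family and shows that all matrix units are attained
    ([walk_irreducible]). Finally the matrix entries of [A] are power series in [t]
    whose coefficients are the Fourier coefficients of [A] along the walks; [a_p] is
    one of them, so some entry does not vanish for small [t]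
    ([l2dot_walk_neq0], [walk_separates]). *)

(** * Complex numbers and their unconditional sums *)

Section modulus.
Variable R : realType.
Implicit Types (z w : C R) (r : R).

Lemma norm_cabs z : `|z| = (cabs z)%:C%C :> C R.
Proof. by []. Qed.

Lemma cabsM z w : cabs (z * w) = cabs z * cabs w.
Proof. exact: Normc.normcM. Qed.

Lemma le_cabsD z w : cabs (z + w) <= cabs z + cabs w.
Proof. exact: le_normcD. Qed.

Lemma cabsN z : cabs (- z) = cabs z.
Proof. exact: normcN. Qed.

Lemma cabsB z w : cabs (z - w) = cabs (w - z).
Proof. by rewrite -cabsN opprB. Qed.

Lemma cabs_eq0 z : cabs z = 0 -> z = 0.
Proof. exact: Normc.eq0_normc. Qed.

Lemma cabs1 : cabs (1 : C R) = 1.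
Proof. exact: Normc.normc1. Qed.

Lemma cabsV z : cabs z^-1 = (cabs z)^-1.
Proof. exact: Normc.normcV. Qed.

Lemma cabsX z n : cabs (z ^+ n) = cabs z ^+ n.
Proof.
elim: n => [|n IHn]; first by rewrite !expr0 cabs1.
by rewrite !exprS cabsM IHn.
Qed.

Lemma cabs_real r : cabs (r%:C%C : C R) = `|r|.
Proof. by rewrite /cabs /= expr0n /= addr0 sqrtr_sqr. Qed.

Lemma cabs_conj z : cabs (z^* : C R) = cabs z.
Proof.
have : `|z^* : C R| = `|z| by rewrite norm_conjC.
by rewrite !norm_cabs => -[].
Qed.

Lemma cabs_sum (J : Type) (s : seq J) (F : J -> C R) :
  cabs (\sum_(i <- s) F i) <= \sum_(i <- s) cabs (F i).
Proof.
elim: s => [|i s IHs]; first by rewrite !big_nil cabs0.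
by rewrite !big_cons (le_trans (le_cabsD _ _))// lerD2l.
Qed.

Lemma cabs_gt0 z : (0 < cabs z) = (z != 0).
Proof.
rewrite lt_def cabs_ge0 andbT; congr negb.
by apply/eqP/eqP => [/cabs_eq0//|->]; rewrite cabs0.
Qed.

Lemma nbhs_cabs z (U : set (C R)) : nbhs z U ->
  exists2 e : R, 0 < e & forall w, cabs (z - w) < e -> U w.
Proof.
move=> /nbhs_ballP[e e0 eU]; have : 0 < e := e0.
rewrite (ltcE 0 e) => /andP[/eqP Ie Re0]; exists (complex.Re e) => // w zw.
apply: eU; rewrite -ball_normE/= norm_cabs.
by rewrite (ltcE _ e) /= Ie eqxx.
Qed.

End modulus.

Section unconditional_sums.
Variable R : realType.
Implicit Types I J : choiceType.

(** Convergence along the finite subsets, with an explicit limit: [sum f] is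
    meaningful only when such a limit exists, since the limit operator returns an
    arbitrary value otherwise. *)
Definition hassum I (f : I -> C R) (l : C R) : Prop :=
  forall e : R, 0 < e -> exists A : {fset I}, forall B : {fset I},
    (A `<=` B)%fset -> cabs (\sum_(i <- B) f i - l) < e.

Lemma hassum_sum I (f : I -> C R) l : hassum f l -> sum f = l.
Proof.
move=> fl; apply: (@cvg_lim _ _ _ _ (totally_filter (I := I))).
  exact: norm_hausdorff.
move=> U /nbhs_cabs[e e0 eU]; have [A hA] := fl _ e0.
exists A => // B AB /=; apply: eU.
by rewrite /partial_sum -(big_seq_fsetE _ B xpredT f) /= cabsB; exact: hA.
Qed.

Lemma hassum_lin I (f g : I -> C R) a b c : hassum f a -> hassum g b ->
  hassum (fun i => c * f i + g i) (c * a + b).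
Proof.
move=> fa gb e e0; have c0 : 0 < cabs c + 1 by rewrite ltr_wpDl ?cabs_ge0.
have ec0 : 0 < e / 2 / (cabs c + 1) by rewrite !divr_gt0.
have e20 : 0 < e / 2 by rewrite divr_gt0.
have [[A hA] [B hB]] := (fa _ ec0, gb _ e20).
exists (A `|` B)%fset => D; rewrite fsubUset => /andP[/hA{}hA /hB{}hB].
rewrite big_split /= -mulr_sumr opprD addrACA -mulrBr.
apply: le_lt_trans (le_cabsD _ _) _; rewrite cabsM.
rewrite [ltRHS](splitr e); apply: ler_ltD hB.
apply: le_trans (ler_wpM2l (cabs_ge0 _) (ltW hA)) _.
by rewrite mulrCA ger_pMr// ler_pdivrMr// mul1r lerDl.
Qed.

Lemma eq_hassum I (f g : I -> C R) l : f =1 g -> hassum f l -> hassum g l.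
Proof. by move=> fg; have -> : f = g by apply/funext. Qed.

Lemma hassum_le I (f : I -> C R) l M : hassum f l ->
  (forall A : {fset I}, \sum_(i <- A) cabs (f i) <= M) -> cabs l <= M.
Proof.
move=> fl fM; apply/ler_addgt0Pr => e e0; have [A hA] := fl _ e0.
have {}hA := hA A (fsubset_refl A).
rewrite -[l](subrK (\sum_(i <- A) f i)) addrC.
apply: le_trans (le_cabsD _ _) _; rewrite cabsB lerD ?(ltW hA)//.
exact: le_trans (cabs_sum _ _) _.
Qed.

Let hassum_ge0 I (f : I -> R) M : (forall i, 0 <= f i) ->
  (forall A : {fset I}, \sum_(i <- A) f i <= M) ->
  exists l, hassum (fun i => (f i)%:C%C : C R) l.
Proof.
move=> f0 fM; pose E := [set \sum_(i <- A) f i | A in [set: {fset I}]].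
have supE : has_sup E.
  split; first by exists (\sum_(i <- fset0) f i), fset0.
  by exists M => _ [A _ <-].
exists ((sup E)%:C%C : C R) => e e0.
have [_ [A _ <-] ltA] := sup_adherent e0 supE.
exists A => B AB; rewrite -rmorph_sum -rmorphB cabs_real.
have leB : \sum_(i <- B) f i <= sup E by apply: ub_le_sup; [case: supE|exists B].
rewrite ler0_norm ?subr_le0// opprB ltrBlDr -ltrBlDl.
apply: lt_le_trans ltA _.
rewrite (big_fsetID _ (fun i => i \in A) B) /=.
have -> : [fset x in B | x \in A]%fset = A.
  apply/fsetP => x; rewrite !inE; apply: andb_idl.
  by move/fsubsetP : AB; exact.
by rewrite lerDl sumr_ge0.
Qed.

(** The summand is a combination of the families [|f| + Re f], [|f| + Im f] and
    [|f|], which are nonnegative, so that their partial sums increase to a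
    supremum. *)
Lemma abs_hassum I (f : I -> C R) M :
  (forall A : {fset I}, \sum_(i <- A) cabs (f i) <= M) -> exists l, hassum f l.
Proof.
move=> fM.
have bnd (g : I -> R) : (forall i, `|g i| <= cabs (f i)) ->
    exists l, hassum (fun i => (cabs (f i) + g i)%:C%C : C R) l.
  move=> gf; apply: (@hassum_ge0 _ _ (M + M)) => [i|A].
    by have := gf i; rewrite ler_norml => /andP[+ _]; rewrite -subr_ge0 opprK addrC.
  rewrite big_split /= lerD// (le_trans _ (fM A))// ler_sum// => i _.
  exact: le_trans (ler_norm _) _.
have Ref i : `|complex.Re (f i)| <= cabs (f i).
  case: (f i) => a b; rewrite /cabs /= -sqrtr_sqr ler_wsqrtr// lerDl sqr_ge0.
  by [].
have Imf i : `|complex.Im (f i)| <= cabs (f i).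
  by case: (f i) => a b; rewrite /cabs /= -sqrtr_sqr ler_wsqrtr// lerDr sqr_ge0.
have [a ha] := bnd _ Ref; have [b hb] := bnd _ Imf.
have [c hc] : exists l, hassum (fun i => (cabs (f i))%:C%C : C R) l.
  by apply: (@hassum_ge0 _ _ M) => // i; exact: cabs_ge0.
pose ii : C R := 'i%C.
exists (ii * b + (- (1 + ii) * c + a)).
apply: eq_hassum (hassum_lin ii hb (hassum_lin (- (1 + ii)) hc ha)) => i.
rewrite [RHS](complexE (f i) : f i = _ + ii * _) !rmorphD /=; ring.
Qed.

(** [L p] renames basis vectors injectively and has no other coordinates; this is what
    its adjoint is computed with. *)
Lemma hassum_reindex I J (D : pred I) (m : I -> J) (F : J -> C R) l :
  {in D &, injective m} ->
  (forall u, F u != 0 -> exists2 w, D w & m w = u) ->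
  hassum F l -> hassum (fun w => if D w then F (m w) else 0) l.
Proof.
move=> minj Fm Fl e e0; have [A hA] := Fl _ e0.
(* A partial inverse of [m]: the finite subsets of [I] that matter are those
   containing the preimages of the elements of [A]. *)
pose h u : option I :=
  if pselect (exists2 w, D w & m w = u) is left H
  then Some (projT1 (cid2 H)) else None.
exists [fset w in pmap h A]%fset => B /fsubsetP AB.
rewrite -big_mkcond /=.
pose mB := [fset m w | w in [fset w in B | D w]]%fset.
have -> : \sum_(i <- B | D i) F (m i) = \sum_(u <- mB) F u.
  rewrite big_fset_condE [RHS]big_imfset // => x y.
  by rewrite !inE => /andP[_ Dx] /andP[_ Dy]; exact: minj.
rewrite (@big_fset_incl _ _ _ _ mB (mB `|` A)%fset F) ?fsubsetUl//; last first.
  move=> u; rewrite inE => /orP[->//|uA]; apply: contraNeq => Fu.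
  have [w Dw mw] := Fm _ Fu; have hw : h u = Some w.
    rewrite /h; case: pselect => [H|[]]; last by exists w.
    congr Some; case: cid2 => w' /= Dw' mw'.
    by apply: minj => //; rewrite mw'.
  apply/imfsetP; exists w => //=; rewrite !inE Dw andbT.
  by apply: AB; rewrite !inE /= mem_pmap -hw map_f.
by apply: hA; rewrite fsubsetUr.
Qed.

Lemma hassum_single I (f : I -> C R) i :
  (forall j, j != i -> f j = 0) -> hassum f (f i).
Proof.
move=> f0 e e0; exists [fset i]%fset => B AB.
rewrite -(@big_fset_incl _ _ _ _ _ B f AB) ?big_seq_fset1 ?subrr ?cabs0// => j _.
by rewrite inE; exact: f0.
Qed.

End unconditional_sums.

(** * The inner product of square-summable families *)

Section inner_product.
Variables (R : realType) (I : choiceType).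
Implicit Types (x y z g : l2 R I) (f : I -> C R) (c : C R).

Lemma sum_sqr_le_sqnorm f (A : {fset I}) :
  ((\sum_(i <- A) cabs (f i) ^+ 2)%:E <= sqnorm f)%E.
Proof.
apply: esum_ge; exists [set` A]; first by split.
by rewrite fsbig_finite//= set_fsetK sumEFin.
Qed.

Lemma sqnorm_le f (M : R) :
  (forall A : {fset I}, \sum_(i <- A) cabs (f i) ^+ 2 <= M) ->
  (sqnorm f <= M%:E)%E.
Proof.
move=> fM; apply: ge_ereal_sup => _ /= [X [finX _] <-].
by rewrite fsbig_finite//= sumEFin lee_fin.
Qed.

Lemma sqnormE x : (l2norm x ^+ 2)%:E = sqnorm x.
Proof.
have fin : sqnorm x \is a fin_num.
  by rewrite ge0_fin_numE ?sqnorm_ge0//; exact/asboolP/(l2P x).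
by rewrite sqr_sqrtr ?fineK// fine_ge0// sqnorm_ge0.
Qed.

Lemma l2norm_ge0 x : 0 <= l2norm x.
Proof. exact: sqrtr_ge0. Qed.

Lemma sum_sqr_le x (A : {fset I}) : \sum_(i <- A) cabs (x i) ^+ 2 <= l2norm x ^+ 2.
Proof. by rewrite -lee_fin sqnormE sum_sqr_le_sqnorm. Qed.

Lemma l2norm_le x (M : R) : 0 <= M ->
  (forall A : {fset I}, \sum_(i <- A) cabs (x i) ^+ 2 <= M ^+ 2) -> l2norm x <= M.
Proof.
move=> M0 /sqnorm_le; rewrite -sqnormE lee_fin => xM.
by rewrite -(@ler_pXn2r _ 2) ?nnegrE ?l2norm_ge0.
Qed.

Lemma cabs_le_l2norm x i : cabs (x i) <= l2norm x.
Proof.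
rewrite -(@ler_pXn2r _ 2) ?nnegrE ?l2norm_ge0 ?cabs_ge0//.
by have := sum_sqr_le x [fset i]%fset; rewrite big_seq_fset1.
Qed.

Lemma sum_pred1_le1 (A : {fset I}) (i : I) :
  \sum_(j <- A) (j == i)%:R <= 1 :> R.
Proof.
have [iA|iA] := boolP (i \in A).
  rewrite (big_fsetD1 i)//= eqxx big_seq big1 ?addr0// => j.
  by rewrite !inE => /andP[/negbTE ->].
by rewrite big_seq big1// => j jA; case: eqP => // ji; rewrite -ji jA in iA.
Qed.

Lemma mul_le_sqr (a b : R) : a * b <= a ^+ 2 + b ^+ 2.
Proof.
rewrite -subr_ge0; have -> : a ^+ 2 + b ^+ 2 - a * b =
  (a - b) ^+ 2 / 2 + (a ^+ 2 + b ^+ 2) / 2 by field.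
by rewrite addr_ge0// divr_ge0 ?addr_ge0 ?sqr_ge0.
Qed.

Lemma l2dot_hassum x y : hassum (fun i => x i * (y i)^*) (l2dot x y).
Proof.
have [l hl] : exists l, hassum (fun i => x i * (y i)^*) l.
  apply: (@abs_hassum _ _ _ (l2norm x ^+ 2 + l2norm y ^+ 2)) => A.
  apply: le_trans (lerD (sum_sqr_le x A) (sum_sqr_le y A)).
  rewrite -big_split ler_sum//= => i _.
  by rewrite cabsM cabs_conj mul_le_sqr.
by rewrite /l2dot (hassum_sum hl).
Qed.

Lemma l2dot_lin c x y z : l2dot (c *: x + y) z = c * l2dot x z + l2dot y z.
Proof.
apply: hassum_sum; have := hassum_lin c (l2dot_hassum x z) (l2dot_hassum y z).
apply: eq_hassum => i.
by rewrite -[(c *: x + y) i]/(c * x i + y i) mulrDl mulrA.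
Qed.

Lemma l2dot0 z : l2dot 0 z = 0.
Proof. by have := l2dot_lin (-1) 0 0 z; rewrite scaler0 addr0 mulN1r addNr. Qed.

Lemma l2dotB x y z : l2dot (x - y) z = l2dot x z - l2dot y z.
Proof. by rewrite addrC -scaleN1r l2dot_lin mulN1r addrC. Qed.

Lemma l2dotZ c x z : l2dot (c *: x) z = c * l2dot x z.
Proof. by rewrite -[c *: x]addr0 l2dot_lin l2dot0 addr0. Qed.

Lemma l2dot_delta x i : l2dot x (l2_delta R i) = x i.
Proof.
apply: hassum_sum; have -> : x i = x i * (l2_delta R i i)^*.
  by rewrite /= eqxx conjC1 mulr1.
apply: hassum_single => j /negbTE ji.
by rewrite /= ji conjC0 mulr0.
Qed.

Lemma l2dot_delta_l y i : l2dot (l2_delta R i) y = (y i)^*.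
Proof.
apply: hassum_sum; have -> : (y i)^* = l2_delta R i i * (y i)^*.
  by rewrite /= eqxx mul1r.
apply: hassum_single => j /negbTE ji.
by rewrite /= ji mul0r.
Qed.

(** The weights [a] and [b] make this both the source of the Cauchy-Schwarz
    inequality and, with [g] another vector than [y], a domination estimate. *)
Lemma l2dot_le x y g (a b : R) : 0 <= a -> 0 <= b ->
  (forall i, cabs (x i) * cabs (y i) <= a * cabs (x i) ^+ 2 + b * cabs (g i) ^+ 2) ->
  cabs (l2dot x y) <= a * l2norm x ^+ 2 + b * l2norm g ^+ 2.
Proof.
move=> a0 b0 xyg; apply: hassum_le (l2dot_hassum x y) _ => A.
apply: le_trans (lerD (ler_wpM2l a0 (sum_sqr_le x A)) (ler_wpM2l b0 (sum_sqr_le g A))).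
rewrite !mulr_sumr -big_split ler_sum//= => i _.
by rewrite cabsM cabs_conj.
Qed.

End inner_product.

(** * Bounded operators and the weak operator topology *)

Section operators.
Variables (R : realType) (I : choiceType).
Implicit Types (x y z : l2 R I) (S T A B : op R I).

Lemma wot_continuous_dot x y :
  continuous ((fun T : wot R I => l2dot (T x) y) : wot R I -> C R).
Proof.
move=> T; apply: (@continuous_comp _ _ _ (@wot_coef R I : wot R I -> _)
  (fun h => h (x, y))).
  exact: initial_continuous.
exact: (@proj_continuous _ (fun=> C R) (x, y)).
Qed.

Lemma wot_continuous_coord x i :
  continuous ((fun T : wot R I => T x i) : wot R I -> C R).
Proof.
have -> : (fun T : wot R I => T x i) = (fun T => l2dot (T x) (l2_delta R i)).
  by apply/funext => T; rewrite l2dot_delta.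
exact: wot_continuous_dot.
Qed.

(** Membership in a weak closure is only ever used to carry over equations between
    weakly continuous functions. *)
Lemma wot_closure_eq0 (F : wot R I -> C R) (D : set (op R I)) T :
  continuous F -> (forall A, D A -> F A = 0) -> wot_closure D T -> F T = 0.
Proof.
move=> cF DF [_ DT].
have cl : closed (F @^-1` [set 0]).
  apply: closed_comp => [? _|]; first exact: cF.
  exact/accessible_closed_set1/hausdorff_accessible/norm_hausdorff.
by apply: cl; apply: closure_subset DT; exact: DF.
Qed.

Lemma bounded_op0 T : bounded_op T -> T 0 = 0.
Proof.
move=> [linT _]; have := linT (-1) 0 0.
by rewrite scaler0 addr0 scaleN1r addNr.
Qed.

Lemma bounded_op_ge0 T : bounded_op T ->
  exists2 c : R, 0 <= c & forall x, l2norm (T x) <= c * l2norm x.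
Proof.
move=> [_ [c Tc]]; exists `|c| => // x; apply: le_trans (Tc x) _.
by rewrite ler_wpM2r ?l2norm_ge0 ?ler_norm.
Qed.

Lemma bounded_op_subalgebra : is_subalgebra (@bounded_op R I).
Proof.
split=> [|a A B bA bB|A B bA bB].
- split=> [a x y|]; first by rewrite scaler0 addr0.
  exists 0 => x; rewrite mul0r; apply: l2norm_le => // D.
  by rewrite big1 ?expr0n// => i _; rewrite cabs0 expr0n.
- have [[linA _] [linB _]] := (bA, bB).
  split=> [b x y|].
    rewrite -[LHS]/(a *: A (b *: x + y) + B (b *: x + y)).
    rewrite -[RHS]/(b *: (a *: A x + B x) + (a *: A y + B y)).
    by rewrite linA linB !scalerDr !scalerA mulrC addrACA.
  have [[c c0 Ac] [d d0 Bd]] := (bounded_op_ge0 bA, bounded_op_ge0 bB).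
  exists (2 * cabs a * c + 2 * d) => x; apply: l2norm_le => [|D].
    by rewrite mulr_ge0 ?addr_ge0 ?mulr_ge0 ?cabs_ge0 ?l2norm_ge0.
  set u := A x; set v := B x.
  have ca : 0 <= 2 * cabs a ^+ 2 by rewrite mulr_ge0 ?sqr_ge0.
  have -> : (a *: A + B) x = a *: u + v by [].
  (* The constant is far from optimal: it only has to absorb the squares. *)
  apply: (@le_trans _ _ (2 * cabs a ^+ 2 * l2norm u ^+ 2 + 2 * l2norm v ^+ 2)).
    have cst (k : R) (w : l2 R I) : 0 <= k ->
        \sum_(i <- D) k * cabs (w i) ^+ 2 <= k * l2norm w ^+ 2.
      by move=> k0; rewrite -mulr_sumr ler_wpM2l// sum_sqr_le.
    apply: le_trans (lerD (cst _ u ca) (cst _ v (ler0n _ 2))).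
    by rewrite -big_split ler_sum//= => i _; exact: cabs_sqr_lin.
  have su : l2norm u ^+ 2 <= (c * l2norm x) ^+ 2.
    by rewrite ler_pXn2r ?nnegrE ?mulr_ge0 ?l2norm_ge0 ?Ac.
  have sv : l2norm v ^+ 2 <= (d * l2norm x) ^+ 2.
    by rewrite ler_pXn2r ?nnegrE ?mulr_ge0 ?l2norm_ge0 ?Bd.
  have a0 := cabs_ge0 a; have n0 := l2norm_ge0 x.
  apply: (@le_trans _ _
    (2 * cabs a ^+ 2 * (c * l2norm x) ^+ 2 + 2 * (d * l2norm x) ^+ 2)).
    by apply: lerD; apply: ler_wpM2l.
  rewrite -subr_ge0.
  have -> : ((2 * cabs a * c + 2 * d) * l2norm x) ^+ 2
      - (2 * cabs a ^+ 2 * (c * l2norm x) ^+ 2 + 2 * (d * l2norm x) ^+ 2) =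
      2 * (cabs a * c * l2norm x) ^+ 2 + 2 * (d * l2norm x) ^+ 2
      + 8 * (cabs a * c * d * l2norm x ^+ 2) by ring.
  by rewrite !addr_ge0// !mulr_ge0 ?sqr_ge0.
- have [[linA _] [linB _]] := (bA, bB).
  split=> [b x y|]; first by rewrite /= linB linA.
  have [[c c0 Ac] [d d0 Bd]] := (bounded_op_ge0 bA, bounded_op_ge0 bB).
  exists (c * d) => x /=; apply: le_trans (Ac _) _.
  by rewrite -mulrA ler_wpM2l.
Qed.

Lemma opnorm_ge T x : bounded_op T -> l2norm x <= 1 -> l2norm (T x) <= opnorm T.
Proof.
move=> /bounded_op_ge0[c c0 Tc] x1; apply: ub_le_sup; last by exists x.
exists c => _ [z z1 <-]; apply: le_trans (Tc z) _.
by rewrite ler_piMr.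
Qed.

Lemma generated_subalgebra (D : set (op R I)) :
  is_subalgebra (generated_algebra D).
Proof.
split=> [S [[S0 _ _] _]//|a A B gA gB S|A B gA gB S] SD; have [[_ SL SM] _] := SD.
- by apply: SL; [exact: gA|exact: gB].
- by apply: SM; [exact: gA|exact: gB].
Qed.

Lemma subalgebra_sum (D : set (op R I)) (J : Type) (s : seq J)
    (a : J -> C R) (F : J -> op R I) : is_subalgebra D ->
  (forall j, D (F j)) -> D (\sum_(j <- s) a j *: F j).
Proof.
move=> [D0 DL _] DF; elim: s => [|j s IHs]; first by rewrite big_nil.
by rewrite big_cons; exact: DL.
Qed.

End operators.

Section semigroupoid_algebra.
Variables (R : realType) (G : digraph).
Implicit Types A B T : op R (dpath G).
Local Notation L := (@Lop R G).
Local Notation LG := (@free_semigroupoid_algebra R G).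
Local Notation alg := (generated_algebra (range L)).

Lemma alg_bounded T : alg T -> bounded_op T.
Proof.
apply; split; first exact: bounded_op_subalgebra.
by move=> _ [p _ <-]; exact: Lop_bounded.
Qed.

Lemma Lop_alg p : alg (L p).
Proof. by move=> S [_]; apply; exists p. Qed.

Lemma alg_LG T : alg T -> LG T.
Proof.
by move=> aT; split; [exact: alg_bounded|exact: subset_closure].
Qed.

Lemma LG_bounded T : LG T -> bounded_op T.
Proof. by case. Qed.

(** The operations reach the generated algebra, and its weak closure follows because
    equations between weakly continuous functions are closed conditions. *)
Lemma LG_ind (J : Type) (F : J -> wot R (dpath G) -> C R) :
  (forall j, continuous (F j)) ->
  is_subalgebra [set T | forall j, F j T = 0] ->
  (forall p j, F j (L p) = 0) -> forall T, LG T -> forall j, F j T = 0.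
Proof.
move=> cF subF LF T LT j; apply: (wot_closure_eq0 (cF j)) LT => A.
by move=> /(_ [set T | forall j, F j T = 0]); apply; split=> // _ [p _ <-].
Qed.

(** Right multiplication by [L p] is weakly continuous, since the coefficients of
    [T (L p)] are coefficients of [T]. *)
Lemma LG_comp_Lop T p : LG T -> LG (T \o L p).
Proof.
move=> LT; split.
  have [_ _] := @bounded_op_subalgebra R (dpath G).
  by apply; [exact: LG_bounded|exact: Lop_bounded].
have cR : continuous ((fun A => A \o L p) : wot R (dpath G) -> wot R (dpath G)).
  apply: continuous_comp_initial.
  move=> A; apply/cvg_sup => [|[x y] U [_ [[V oV <-] VA]] VU] /=.
    exact: (@fmap_filter _ _ _ _ (@nbhs_filter (wot R (dpath G)) A)).
  have nV : nbhs (l2dot (A (L p x)) y) V by exact: open_nbhs_nbhs.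
  have nA := @wot_continuous_dot _ _ (L p x) y A V nV.
  by apply: (@filterS _ (nbhs (A : wot R (dpath G))) _ _ _ _ nA) => B; exact: VU.
move=> U /(cR T) /(proj2 LT)[A [aA UA]]; exists (A \o L p); split=> //.
by have [_ _] := generated_subalgebra (range L); apply => //; exact: Lop_alg.
Qed.

End semigroupoid_algebra.

(** * Compressions to finite-dimensional coinvariant subspaces *)

Section norm_estimates.
Variables (R : realType) (I : choiceType).
Implicit Types (x y : l2 R I) (T : op R I) (c : C R).

Lemma l2norm_eq0 x : l2norm x = 0 -> x = 0.
Proof.
move=> x0; apply: val_inj; apply/funext => i /=; apply/cabs_eq0/eqP.
by rewrite eq_le cabs_ge0 andbT -x0 cabs_le_l2norm.
Qed.

(** Termwise, [|x i| |y i| <= a |x i|^2 + b |y i|^2] as soon as [4 a b = 1]; the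
    choice [a = |y| / (2 |x|)] balances the two sums. *)
Lemma cauchy_schwarz x y : cabs (l2dot x y) <= l2norm x * l2norm y.
Proof.
have [x0|x0] := eqVneq (l2norm x) 0.
  by rewrite (l2norm_eq0 x0) l2dot0 cabs0 mulr_ge0 ?l2norm_ge0.
have [y0|y0] := eqVneq (l2norm y) 0.
  rewrite y0 mulr0 (_ : l2dot x y = 0) ?cabs0//.
  apply: hassum_sum => e e0; exists fset0 => B _.
  by rewrite big1 ?subrr ?cabs0// => i _; rewrite (l2norm_eq0 y0)/= conjC0 mulr0.
have X0 : 0 < l2norm x by rewrite lt_def x0 l2norm_ge0.
have Y0 : 0 < l2norm y by rewrite lt_def y0 l2norm_ge0.
set X := l2norm x in x0 X0 *; set Y := l2norm y in y0 Y0 *.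
have -> : X * Y = (Y / (2 * X)) * X ^+ 2 + (X / (2 * Y)) * Y ^+ 2.
  by field; rewrite x0 y0.
apply: l2dot_le => [||i]; rewrite ?divr_ge0 ?mulr_ge0 ?(ltW X0) ?(ltW Y0)//.
set u := cabs (x i); set v := cabs (y i).
rewrite -subr_ge0 (_ : _ - _ = (Y * u - X * v) ^+ 2 / (2 * X * Y)).
  by rewrite divr_ge0 ?sqr_ge0// !mulr_ge0 ?(ltW X0) ?(ltW Y0).
by field; rewrite x0 y0.
Qed.

Lemma l2normZ_le c x : l2norm (c *: x) <= cabs c * l2norm x.
Proof.
apply: l2norm_le => [|A]; first by rewrite mulr_ge0 ?cabs_ge0 ?l2norm_ge0.
rewrite exprMn (le_trans _ (ler_wpM2l (sqr_ge0 _) (sum_sqr_le x A)))//.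
rewrite mulr_sumr ler_sum// => i _.
by rewrite -[(c *: x) i]/(c * x i) cabsM exprMn.
Qed.

Lemma opnorm_ge0 T : bounded_op T -> 0 <= opnorm T.
Proof.
move=> bT; apply: le_trans (l2norm_ge0 (T 0)) (opnorm_ge bT _).
by apply: l2norm_le => // A; rewrite big1 ?expr1n// => i _; rewrite cabs0 expr0n.
Qed.

(** Scaling by [|x| + 1] instead of [|x|] brings [x] into the unit ball also when
    it vanishes. *)
Lemma l2norm_opnorm T x : bounded_op T -> l2norm (T x) <= opnorm T * (l2norm x + 1).
Proof.
move=> bT; set s := l2norm x + 1; have s0 : 0 < s by rewrite ltr_wpDl ?l2norm_ge0.
pose c : C R := s%:C%C; have cc : cabs c = s by rewrite cabs_real gtr0_norm.
have c0 : c != 0 by rewrite -cabs_gt0 cc.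
have -> : T x = c *: T (c^-1 *: x).
  have [linT _] := bT.
  have := linT c^-1 x 0; rewrite !addr0 (bounded_op0 bT) addr0 => ->.
  by rewrite scalerA mulfV// scale1r.
apply: le_trans (l2normZ_le _ _) _; rewrite cc mulrC ler_wpM2r ?(ltW s0)//.
apply: opnorm_ge => //; apply: le_trans (l2normZ_le _ _) _.
by rewrite cabsV cc mulrC ler_pdivrMr// mul1r lerDl.
Qed.

End norm_estimates.

Section coinvariant.
Variables (R : realType) (G : digraph) (K : finType).
Variables x y : K -> l2 R (dpath G).
Implicit Types A B T : op R (dpath G).
Local Notation L := (@Lop R G).
Local Notation LG := (@free_semigroupoid_algebra R G).

Let continuous_sub_sum (X : topologicalType) (f : X -> C R) (g : K -> X -> C R)
    (c : K -> C R) : continuous f -> (forall k, continuous (g k)) ->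
  continuous (fun t => f t - \sum_k g k t * c k).
Proof.
move=> cf cg t; apply: cvgB; first exact: cf.
apply: cvg_big => [|k _]; first exact: pseudometric_normed_Zmodule.add_continuous.
apply: cvgM; [exact: cg|exact: cvg_cst].
Qed.

(** In terms of the adjoint, [T^*] maps [y i] to the combination of the [y k] with
    coefficients the conjugates of [<T (x k), y i>]. The span of the [y k] is thus
    invariant under [T^*], and coordinates in it are read off by the [x k]. *)
Definition coinvariant T : Prop := forall z i,
  l2dot (T z) (y i) = \sum_k l2dot (T (x k)) (y i) * l2dot z (y k).

Lemma coinvariant_LG : (forall p, coinvariant (L p)) ->
  forall T, LG T -> coinvariant T.
Proof.
move=> coL T LT z i; apply/eqP; rewrite -subr_eq0; apply/eqP.
pose F (zi : l2 R (dpath G) * K) (A : wot R (dpath G)) : C R :=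
  l2dot (A zi.1) (y zi.2) - \sum_k l2dot (A (x k)) (y zi.2) * l2dot zi.1 (y k).
have FE A : (forall zi, F zi A = 0) <-> coinvariant A.
  split=> [h {}z {}i|h [{}z {}i]].
    by apply/eqP; rewrite -subr_eq0; apply/eqP/(h (z, i)).
  by rewrite /F h subrr.
apply: (LG_ind (F := F) _ _ _ LT (z, i)) => [zi| |p].
- apply: continuous_sub_sum => [|k]; exact: wot_continuous_dot.
- split=> [|a A B /FE hA /FE hB|A B /FE hA /FE hB]; apply/FE => {}z {}i.
  + rewrite -[LHS]/(l2dot 0 (y i)) -[RHS]/(\sum_k l2dot 0 (y i) * l2dot z (y k)).
    by rewrite l2dot0 big1// => k _; rewrite mul0r.
  + rewrite -[(a *: A + B) z]/(a *: A z + B z) l2dot_lin hA hB mulr_sumr -big_split.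
    apply: eq_bigr => k _ /=.
    by rewrite -[(a *: A + B) _]/(a *: A (x k) + B (x k)) l2dot_lin mulrDl mulrA.
  + rewrite /= hA; under [LHS]eq_bigr do rewrite hB mulr_sumr.
    rewrite exchange_big; apply: eq_bigr => k _ /=.
    by rewrite hA mulr_suml; apply: eq_bigr => l _; rewrite mulrA.
- by apply/FE; exact: coL.
Qed.

Definition compression T : 'M[C R]_#|K| :=
  \matrix_(i, j) l2dot (T (x (enum_val j))) (y (enum_val i)).

Lemma compression_lin a A B :
  compression (a *: A + B) = a *: compression A + compression B.
Proof.
apply/matrixP => i j; rewrite !mxE.
by rewrite -[(a *: A + B) _]/(a *: A (x (enum_val j)) + B (x (enum_val j))) l2dot_lin.
Qed.

Lemma compression_sum (J : Type) (s : seq J) (a : J -> C R) (F : J -> op R (dpath G)) :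
  compression (\sum_(j <- s) a j *: F j) = \sum_(j <- s) a j *: compression (F j).
Proof.
elim: s => [|j s IHs]; last by rewrite !big_cons compression_lin IHs.
rewrite !big_nil; apply/matrixP => i j; rewrite !mxE.
exact: l2dot0.
Qed.

Lemma compressionM A B : coinvariant A ->
  compression (A \o B) = compression A *m compression B.
Proof.
move=> coA; apply/matrixP => i j; rewrite !mxE /= coA.
rewrite (reindex _ (onW_bij _ (@enum_val_bij K))) /=.
by apply: eq_bigr => k _; rewrite !mxE.
Qed.

Lemma compression_representation : (forall p, coinvariant (L p)) ->
  is_representation compression.
Proof.
move=> coL; split=> [a A B _ _|A B LA _|A LA U].
- exact: compression_lin.
- exact/compressionM/coinvariant_LG.
move=> /nbhs_ballP[e e0 eU]; have : 0 < e := e0.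
rewrite (ltcE 0 e) => /andP[/eqP Ie Re0]; set r := complex.Re e in Re0.
(* [M] bounds all the products of norms that control the matrix entries. *)
pose M := \sum_i \sum_j (l2norm (x j) + 1) * l2norm (y i) + 1.
have M0 : 0 < M.
  rewrite ltr_wpDl// !sumr_ge0// => i _; rewrite sumr_ge0// => j _.
  by rewrite mulr_ge0 ?addr_ge0 ?l2norm_ge0.
have leM i j : (l2norm (x j) + 1) * l2norm (y i) <= M.
  rewrite /M (bigD1 i)//= (bigD1 j)//= -!addrA lerDl !addr_ge0// sumr_ge0//.
    by move=> *; rewrite mulr_ge0 ?addr_ge0 ?l2norm_ge0.
  by move=> *; rewrite sumr_ge0// => *; rewrite mulr_ge0 ?addr_ge0 ?l2norm_ge0.
exists (r / M) => [|B LB dAB]; first by rewrite divr_gt0.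
apply: eU; split=> // i j; rewrite -ball_normE /= norm_cabs (ltcE _ e) /= Ie eqxx /=.
rewrite !mxE cabsB -l2dotB; set k := enum_val i; set l := enum_val j.
have bBA : bounded_op (B - A).
  have [_ lin _] := @bounded_op_subalgebra R (dpath G).
  by rewrite addrC -scaleN1r; apply: lin; exact: LG_bounded.
apply: le_lt_trans (cauchy_schwarz _ _) _.
apply: (@le_lt_trans _ _ (opnorm (B - A) * M)).
  apply: (@le_trans _ _ (opnorm (B - A) * ((l2norm (x l) + 1) * l2norm (y k)))).
    by rewrite mulrA ler_wpM2r ?l2norm_ge0// (l2norm_opnorm _ bBA).
  by rewrite ler_wpM2l// opnorm_ge0.
by rewrite -ltr_pdivlMr.
Qed.

(** It suffices to attain the matrix units up to nonzero factors. *)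
Lemma compression_irreducible :
  (forall i j, exists p, exists2 c : C R, c != 0 &
     forall k l, l2dot (L p (x l)) (y k) = c * ((k == i) && (l == j))%:R) ->
  is_irreducible compression.
Proof.
move=> units; apply/seteqP; split=> // M _.
have /choice[p hp] : forall ij : 'I_#|K| * 'I_#|K|, exists p, exists2 c : C R, c != 0 &
    compression (L p) = c *: delta_mx ij.1 ij.2.
  move=> [i j]; have [p [c c0 hp]] := units (enum_val i) (enum_val j).
  exists p; exists c => //; apply/matrixP => k l.
  by rewrite !mxE hp !(inj_eq enum_val_inj).
have /choice[c hc] : forall ij, exists c : C R, c != 0 /\
    compression (L (p ij)) = c *: delta_mx ij.1 ij.2.
  by move=> ij; have [c c0 hc] := hp ij; exists c.
exists (\sum_ij (M ij.1 ij.2 / c ij) *: L (p ij)).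
  apply: alg_LG; exact: (subalgebra_sum _ _
    (generated_subalgebra (range L)) (fun ij => Lop_alg (p ij))).
rewrite compression_sum [RHS]matrix_sum_delta pair_bigA /=.
apply: eq_bigr => ij _; have [c0 ->] := hc ij.
by rewrite scalerA divfK.
Qed.

End coinvariant.

(** * Fourier coefficients *)

Section path_algebra.
Variable G : digraph.
Implicit Types p q u v w : dpath G.

Definition plen p := size (pedges p).

Lemma dpath_eq u v : psrc u = psrc v -> pedges u = pedges v -> u = v.
Proof.
move=> esrc eedges; apply: val_inj.
by rewrite [LHS]surjective_pairing [RHS]surjective_pairing; congr (_, _).
Qed.

Lemma pcompP p w u : pcomp p w = Some u <->
  [/\ prng w = psrc p, psrc u = psrc w & pedges u = pedges w ++ pedges p].
Proof.
rewrite /pcomp; case: eqP => [h|h]; last by split=> // -[].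
split=> [[<-]//|[_ eu eu']]; congr Some; exact: dpath_eq.
Qed.

Lemma pcomp_plen p w u : pcomp p w = Some u -> plen u = (plen w + plen p)%N.
Proof. by move=> /pcompP[_ _ eu]; rewrite /plen eu size_cat. Qed.

Lemma prngE u : prng u = last (psrc u) (map (@rng G) (pedges u)).
Proof. by []. Qed.

Lemma pcomp_prng p w u : pcomp p w = Some u -> prng u = prng p.
Proof.
move=> /pcompP[pw eu eu']; rewrite !prngE eu eu' map_cat last_cat.
by rewrite -pw prngE.
Qed.

Lemma pcomp_cancelr p p' w u :
  pcomp p w = Some u -> pcomp p' w = Some u -> p = p'.
Proof.
move=> /pcompP[sp _ eu] /pcompP[sp' _]; rewrite eu => /eqP.
rewrite eqseq_cat// eqxx /= => /eqP ep; apply: dpath_eq => //.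
by rewrite -sp sp'.
Qed.

(** Associativity is split into two statements, as the product is partial: existence
    of one bracketing gives that of the other. *)
Lemma pcomp_assocl q v p w u : pcomp q v = Some u -> pcomp p w = Some v ->
  exists2 qp, pcomp q p = Some qp & pcomp qp w = Some u.
Proof.
move=> qv pw; have pq : prng p = psrc q.
  by rewrite -(pcomp_prng pw); have /pcompP[] := qv.
exists (DPath (wf_dpath_cat pq)).
  by apply/pcompP.
move: qv pw => /pcompP[_ su eu] /pcompP[sp sv ev].
by apply/pcompP; split; rewrite ?su// eu ev catA.
Qed.

Lemma pcomp_assocr q p qp w u : pcomp q p = Some qp -> pcomp qp w = Some u ->
  exists2 v, pcomp p w = Some v & pcomp q v = Some u.
Proof.
move=> qp_ qpw; have wp : prng w = psrc p.
  by have /pcompP[_ <- _] := qp_; have /pcompP[] := qpw.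
have pw : pcomp p w = Some (DPath (wf_dpath_cat wp)) by apply/pcompP.
exists (DPath (wf_dpath_cat wp)) => //.
have /pcompP[pq sqp eqp] := qp_; have /pcompP[_ su eu] := qpw.
apply/pcompP; split=> //; first by rewrite (pcomp_prng pw).
by rewrite eu eqp catA.
Qed.

Fact vertex_path_wf (a : vertex G) : wf_dpath (a, [::] : seq (edge G)).
Proof. by []. Qed.
Definition vpath a : dpath G := DPath (vertex_path_wf a).

Lemma pcomp_vpathr p : pcomp p (vpath (psrc p)) = Some p.
Proof. by apply/pcompP. Qed.

Lemma pcomp_vpathl p : pcomp (vpath (prng p)) p = Some p.
Proof. by apply/pcompP; rewrite /= cats0. Qed.

Fact wf_take n u : wf_dpath (psrc u, take n (pedges u)).
Proof.
case: u => -[a [|e es]] //= wu; rewrite /psrc /pedges /=.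
case: n => // n; move: wu; rewrite /wf_dpath /= => /andP[-> ewf] /=.
by have := ewf; rewrite -{1}(cat_take_drop n es) cat_path => /andP[].
Qed.
Definition ptake n u : dpath G := DPath (wf_take n u).

Lemma plen_ptake n u : (n <= plen u)%N -> plen (ptake n u) = n.
Proof. exact: size_takel. Qed.

(** Paths compose from right to left and are stored in the order of travel, so that
    a right factor is an initial segment. *)
Lemma ptake_pcomp p w u : pcomp p w = Some u -> w = ptake (plen w) u.
Proof.
move=> /pcompP[_ su eu]; apply: dpath_eq => //.
by rewrite [RHS]/pedges /= eu take_size_cat.
Qed.

End path_algebra.

Section coefficients.
Variables (R : realType) (G : digraph).
Implicit Types (A T : op R (dpath G)) (p q u v w : dpath G).
Local Notation L := (@Lop R G).
Local Notation LG := (@free_semigroupoid_algebra R G).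
Local Notation xi := (@l2_delta R (dpath G)).

Lemma Lop_coord p (z : l2 R (dpath G)) w u : pcomp p w = Some u -> L p z u = z w.
Proof. exact: Lop_funE. Qed.

Lemma Lop_coord0 p (z : l2 R (dpath G)) u :
  (forall w, pcomp p w <> Some u) -> L p z u = 0.
Proof. exact: Lop_fun0. Qed.

(** The [xi w], for [w] ranging over the finitely many initial segments of [u],
    span a subspace invariant under the adjoints of the [L p]. *)
Lemma LG_coord T u z : LG T ->
  T z u = \sum_(k < (plen u).+1) T (xi (ptake k u)) u * z (ptake k u).
Proof.
move=> LT; pose x (k : 'I_(plen u).+1) := xi (ptake k u).
have co p : coinvariant x x (L p).
  move=> {}z i; rewrite l2dot_delta.
  under eq_bigr do rewrite !l2dot_delta.
  have [[w pw]|np] := pselect (exists w, pcomp p w = Some (ptake i u)); last first.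
    rewrite Lop_coord0 => [|w pw]; last by apply: np; exists w.
    by rewrite big1// => k _; rewrite Lop_coord0 ?mul0r// => w pw; apply: np; exists w.
  have lewi : (plen w <= i)%N.
    rewrite -[leqRHS](plen_ptake (_ : i <= plen u)%N) -1?ltnS//.
    by rewrite (pcomp_plen pw) leq_addr.
  have ltw : (plen w < (plen u).+1)%N by exact: leq_ltn_trans lewi (ltn_ord i).
  pose k := Ordinal ltw.
  have wk : w = ptake (plen w) u.
    rewrite {1}(ptake_pcomp pw); apply: dpath_eq => //.
    by rewrite /pedges /= take_takel.
  rewrite (Lop_coord _ pw) (bigD1 k)// (Lop_coord _ pw).
  rewrite big1 => [|l /negP lk].
    by rewrite /= -wk eqxx mul1r addr0.
  rewrite (Lop_coord _ pw) /=.
  case: eqP => [wl|]; last by rewrite mul0r.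
  by case: lk; apply/eqP/val_inj; rewrite /= wl plen_ptake// -ltnS.
have := coinvariant_LG co LT z ord_max; rewrite l2dot_delta.
have -> : ptake (@ord_max (plen u)) u = u.
  by apply: dpath_eq => //; rewrite /pedges /= take_size.
move=> ->; apply: eq_bigr => k _; rewrite !l2dot_delta.
congr (T _ _ * _).
by apply: dpath_eq => //; rewrite /pedges /= take_size.
Qed.

(** The elements of the algebra commute with the right translation [xi p |-> xi
    (p w)], whose graph is [translate w]. *)
Definition translate w (z z' : l2 R (dpath G)) : Prop :=
  (forall p u, pcomp p w = Some u -> z' u = z p) /\
  (forall u, (forall p, pcomp p w <> Some u) -> z' u = 0).

Let contB (X : topologicalType) (f g : X -> C R) :
  continuous f -> continuous g -> continuous (fun t => f t - g t).
Proof. by move=> cf cg t; apply: cvgB; [exact: cf|exact: cg]. Qed.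

Lemma LG_translate w T z z' : LG T -> translate w z z' -> translate w (T z) (T z').
Proof.
move=> LT zz'.
pose H := l2 R (dpath G).
pose J := ({zz : H * H | translate w zz.1 zz.2} * dpath G)%type.
pose F (j : J) (A : wot R (dpath G)) : C R :=
  A (sval j.1).2 j.2 -
  (if pselect (exists p, pcomp p w = Some j.2) is left h
   then A (sval j.1).1 (projT1 (cid h)) else 0).
have FE A : (forall j, F j A = 0) <->
    (forall z z', translate w z z' -> translate w (A z) (A z')).
  split=> [FA {}z {}z' {}zz'|trA [[[{}z {}z'] {}zz'] u]].
    split=> [p u pu|u nu]; have := FA (exist _ (z, z') zz', u);
      rewrite /F /=; case: pselect => h /eqP; rewrite subr_eq0 => /eqP ->.
    - by case: cid => p' /= pu'; rewrite (pcomp_cancelr pu' pu).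
    - by case: h; exists p.
    - by have [p /nu] := h.
    - by [].
  rewrite /F /=; have [tr1 tr2] := trA _ _ zz'.
  case: pselect => h; first by case: cid => p /= pu; rewrite (tr1 _ _ pu) subrr.
  by rewrite subr0 tr2// => p pu; apply: h; exists p.
move: z z' zz'; apply/FE; apply: LG_ind LT.
- move=> j; rewrite /F; case: pselect => h; apply: contB.
  - exact: wot_continuous_coord.
  - exact: wot_continuous_coord.
  - exact: wot_continuous_coord.
  - exact: cst_continuous.
- split=> [|a A B /FE hA /FE hB|A B /FE hA /FE hB]; apply/FE => z z' zz'.
  + by [].
  + have [[a1 a2] [b1 b2]] := (hA _ _ zz', hB _ _ zz').
    split=> [p u pu|u nu].
      rewrite -[LHS]/(a * A z' u + B z' u) -[RHS]/(a * A z p + B z p).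
      by rewrite (a1 _ _ pu) (b1 _ _ pu).
    by rewrite -[LHS]/(a * A z' u + B z' u) a2// b2// mulr0 addr0.
  + exact/hA/hB.
- move=> q; apply/FE => z z' [z1 z2]; split=> [p u pu|u nu].
    have [[p' qp]|nq] := pselect (exists p', pcomp q p' = Some p).
      have [v pv qv] := pcomp_assocr qp pu.
      by rewrite (Lop_coord _ qp) (Lop_coord _ qv) (z1 _ _ pv).
    rewrite [RHS]Lop_coord0 => [|p' qp]; last by apply: nq; exists p'.
    have [[v qv]|nv] := pselect (exists v, pcomp q v = Some u); last first.
      by rewrite Lop_coord0// => v qv; apply: nv; exists v.
    rewrite (Lop_coord _ qv) z2// => p' pv; apply: nq; exists p'.
    have [r qr ru] := pcomp_assocl qv pv.
    by rewrite qr (pcomp_cancelr pu ru).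
  have [[v qv]|nv] := pselect (exists v, pcomp q v = Some u); last first.
    by rewrite Lop_coord0// => v qv; apply: nv; exists v.
  rewrite (Lop_coord _ qv) z2// => p pv.
  by have [r _ ru] := pcomp_assocl qv pv; exact: nu ru.
Qed.

Lemma translate_xi w : translate w (xi (vpath (prng w))) (xi w).
Proof.
split=> [p u pu|u nu] /=; last first.
  by case: eqP => // uw; case: (nu (vpath (prng w))); rewrite uw pcomp_vpathl.
congr (_%:R); congr nat_of_bool; apply/eqP/eqP => [uw|pw].
  by apply: pcomp_cancelr pu _; rewrite uw pcomp_vpathl.
by have := pcomp_vpathl w; rewrite -pw pu => -[].
Qed.

(** [coef T p] is the coefficient of [L p] in the Fourier expansion of [T]. *)
Definition coef T p : C R := T (xi (vpath (psrc p))) p.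

(** Translating [xi (vpath (prng w))] to [xi w] moves the coefficient at [p] to
    the coordinate [p w]. *)
Lemma LG_coef T p w u : LG T -> pcomp p w = Some u -> T (xi w) u = coef T p.
Proof.
move=> LT pu; have [h _] := LG_translate LT (translate_xi w).
by rewrite (h _ _ pu); have /pcompP[-> _ _] := pu.
Qed.

Lemma LG_coef_neq0 T : LG T -> T <> 0 -> exists p, coef T p != 0.
Proof.
move=> LT T0; apply: contrapT => nc; apply: T0; apply/funext => z.
apply: val_inj; apply/funext => u; rewrite [LHS](LG_coord _ _ LT) big1// => k _.
have [_ h] := LG_translate LT (translate_xi (ptake k u)).
have [[p pu]|np] := pselect (exists p, pcomp p (ptake k u) = Some u).
  rewrite (LG_coef LT pu); have [->|cp] := eqVneq (coef T p) 0; first by rewrite mul0r.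
  by case: nc; exists p.
by rewrite h ?mul0r// => p pu; apply: np; exists p.
Qed.

End coefficients.

(** * The representation carried by a backward walk *)

(** A state [k] is entered through the edge [lab k] from the state [tau k]; walks are
    followed backwards from their final state, since the adjoint of [L p] removes
    the last edges of a path. *)
Section backward_walk.
Variables (G : digraph) (K : Type) (tau : K -> K) (lab : K -> edge G).
Hypothesis src_lab : forall k, src (lab k) = rng (lab (tau k)).
Implicit Types (k : K) (n : nat) (p w u : dpath G).

Fixpoint back_edges k n : seq (edge G) :=
  if n is m.+1 then rcons (back_edges (tau k) m) (lab k) else [::].

Lemma size_back_edges k n : size (back_edges k n) = n.
Proof. by elim: n k => //= n IHn k; rewrite size_rcons IHn. Qed.

Lemma back_edgesD k m n :
  back_edges k (m + n) = back_edges (iter m tau k) n ++ back_edges k m.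
Proof.
elim: m k => [|m IHm] k; first by rewrite cats0.
by rewrite addSn /= IHm -iterSr rcons_cat.
Qed.

Let last_back_edges k n :
  last (rng (lab (iter n tau k))) (map (@rng G) (back_edges k n)) = rng (lab k).
Proof. by case: n => //= n; rewrite map_rcons last_rcons. Qed.

Fact back_path_wf k n : wf_dpath (rng (lab (iter n tau k)), back_edges k n).
Proof.
elim: n k => [//|n IHn] k; rewrite iterSr /=.
pose q : dpath G := DPath (IHn (tau k)).
have wf1 : wf_dpath (src (lab k), [:: lab k]) by rewrite /wf_dpath /= eqxx.
have qp : prng q = psrc (DPath wf1).
  by rewrite /psrc /= src_lab -(last_back_edges _ n).
by have := wf_dpath_cat qp; rewrite cats1.
Qed.
Definition back_path k n : dpath G := DPath (back_path_wf k n).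

Lemma plen_back_path k n : plen (back_path k n) = n.
Proof. exact: size_back_edges. Qed.

Lemma prng_back_path k n : prng (back_path k n) = rng (lab k).
Proof. exact: last_back_edges. Qed.

Lemma back_path_pcomp k m n :
  pcomp (back_path k m) (back_path (iter m tau k) n) = Some (back_path k (m + n)).
Proof.
apply/pcompP; split; first exact: prng_back_path.
  by rewrite /psrc /= addnC iterD.
exact: back_edgesD.
Qed.

(** Two factorizations of one list of edges agree once the lengths of their factors
    do. *)
Lemma pcomp_back_path p w k n : pcomp p w = Some (back_path k n) ->
  p = back_path k (plen p) /\ w = back_path (iter (plen p) tau k) (plen w).
Proof.
move=> pw; have := pcomp_plen pw; rewrite plen_back_path => en.
rewrite en addnC in pw.
have /pcompP[h1 h2 h3] := pw.
have /pcompP[h4 h5 h6] := back_path_pcomp k (plen p) (plen w).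
have : pedges w ++ pedges p = pedges (back_path (iter (plen p) tau k) (plen w))
  ++ pedges (back_path k (plen p)) by rewrite -h3 -h6.
move/eqP; rewrite eqseq_cat ?size_back_edges// => /andP[/eqP ew /eqP ep].
have {}ew : w = back_path (iter (plen p) tau k) (plen w).
  by apply: dpath_eq => //; rewrite -h2 -h5.
split=> //; apply: dpath_eq => //.
by rewrite -h1 -h4 {1}ew.
Qed.

End backward_walk.

Section walk_vectors.
Variables (R : realType) (G : digraph) (K : Type) (tau : K -> K) (lab : K -> edge G).
Hypothesis src_lab : forall k, src (lab k) = rng (lab (tau k)).
Implicit Types (k : K) (n : nat) (p w u : dpath G) (t : R).
Local Notation L := (@Lop R G).
Local Notation LG := (@free_semigroupoid_algebra R G).
Local Notation xi := (@l2_delta R (dpath G)).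
Local Notation bk := (back_path src_lab).

(** The vector of the state [k] is the sum over [n] of [t ^+ n] times the basis
    vector of the walk of length [n] ending in [k]; a path is such a walk exactly
    when it is the one of its own length. *)
Definition walk_weight t k u : C R :=
  (if u == bk k (plen u) then t ^+ plen u else 0)%:C%C.

Let geometric_le2 (s : R) n : 0 <= s <= 1 / 2 -> \sum_(i < n) s ^+ i <= 2.
Proof.
move=> /andP[s0 s1]; have h : (1 - s) * \sum_(i < n) s ^+ i = 1 - s ^+ n.
  have := subrX1 s n; rewrite -(opprB s 1) mulNr => <-; by rewrite opprB.
have S0 : 0 <= \sum_(i < n) s ^+ i by rewrite sumr_ge0// => i _; rewrite exprn_ge0.
have X0 : 0 <= s ^+ n by rewrite exprn_ge0.
by nra.
Qed.

Fact walk_weight_l2 t k : 0 <= t <= 1 / 2 -> walk_weight t k \in @l2_pred R (dpath G).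
Proof.
move=> /andP[t0 t1]; apply/asboolP.
apply: le_lt_trans (_ : 2%:E < +oo)%E; last exact: ltry.
apply: sqnorm_le => A; pose N := (\max_(u <- A) plen u).+1.
have t2 : 0 <= t ^+ 2 <= 1 / 2 by rewrite sqr_ge0 /= expr2; nra.
(* There is at most one path in the support for each length. *)
apply: le_trans (geometric_le2 N t2).
apply: (@le_trans _ _ (\sum_(u <- A) \sum_(n < N) (t ^+ 2) ^+ n * (u == bk k n)%:R)).
  rewrite big_seq [leRHS]big_seq ler_sum// => u uA; rewrite /walk_weight.
  rewrite cabs_real real_normK ?num_real //; case: eqP => [uk|_]; last first.
    by rewrite expr0n sumr_ge0// => n _; rewrite mulr_ge0 ?exprn_ge0 ?sqr_ge0.
  have ltu : (plen u < N)%N by rewrite ltnS;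
    exact: (@leq_bigmax_seq _ _ xpredT (@plen G)).
  rewrite (bigD1 (Ordinal ltu))//= -uk eqxx mulr1 -!exprM mulnC.
  by rewrite lerDl sumr_ge0// => n _; rewrite mulr_ge0 ?exprn_ge0 ?sqr_ge0.
rewrite exchange_big ler_sum//= => n _.
rewrite -mulr_sumr ler_piMr ?exprn_ge0 ?sqr_ge0//.
exact: sum_pred1_le1.
Qed.

Variable t : R.
Hypothesis t_bound : 0 < t <= 1 / 2.

Let t_nneg : 0 <= t <= 1 / 2.
Proof. by case/andP: t_bound => /ltW -> ->. Qed.

Definition walk_vec k : l2 R (dpath G) := L2 (walk_weight_l2 k t_nneg).

Lemma walk_vec_conj k u : (walk_vec k u)^* = walk_vec k u.
Proof.
apply: conj_Creal; apply/complex_realP.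
by exists (if u == bk k (plen u) then t ^+ plen u else 0).
Qed.

Lemma walk_vec_back k n : walk_vec k (bk k n) = (t%:C%C : C R) ^+ n.
Proof. by rewrite /= /walk_weight plen_back_path eqxx rmorphXn. Qed.

Lemma walk_vec0 k u : u <> bk k (plen u) -> walk_vec k u = 0.
Proof. by rewrite /= /walk_weight => /eqP/negbTE ->. Qed.

(** This is the adjoint of [L p] on the walk vectors: it carries that of [k] to a
    multiple of that of the state reached from [k] along [p], or kills it. *)
Lemma l2dot_Lop_walk p z k : l2dot (L p z) (walk_vec k) =
  if p == bk k (plen p)
  then (t%:C%C : C R) ^+ plen p * l2dot z (walk_vec (iter (plen p) tau k)) else 0.
Proof.
have hF := l2dot_hassum (L p z) (walk_vec k).
set F := (fun u => _) in hF.
have F0 u : F u != 0 -> (exists2 w, pcomp p w = Some u & u = bk k (plen u)).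
  move=> Fu; have [[w pw]|nw] := pselect (exists w, pcomp p w = Some u); last first.
    by case/eqP: Fu; rewrite /F Lop_coord0 ?mul0r// => w pw; apply: nw; exists w.
  exists w => //; apply: contrapT => nu.
  by case/eqP: Fu; rewrite /F (walk_vec0 nu) conjC0 mulr0.
case: eqP => [pk|pk]; last first.
  apply: hassum_sum => e e0; exists fset0 => B _; rewrite big1 ?subrr ?cabs0// => u _.
  apply/eqP; apply: contraT => /F0[w pw uk]; case: pk.
  by rewrite uk in pw; have [] := pcomp_back_path pw.
set k' := iter _ _ _.
pose m w := odflt w (pcomp p w).
have mP w : prng w = psrc p -> pcomp p w = Some (m w).
  by rewrite /m /pcomp; case: eqP.
have minj : {in [pred w | prng w == psrc p] &, injective m}.
  move=> w w' /eqP/mP pw /eqP/mP pw' e; apply: pcomp_inj pw _.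
  by rewrite e.
have Fm u : F u != 0 -> exists2 w, prng w == psrc p & m w = u.
  move=> /F0[w pw _]; have /pcompP[h _ _] := pw; exists w; first exact/eqP.
  by rewrite /m pw.
rewrite -(hassum_sum (hassum_reindex minj Fm hF)).
apply: hassum_sum.
rewrite -l2dotZ; set c := _ ^+ _.
have := l2dot_hassum (c *: z) (walk_vec k').
apply: eq_hassum => w; rewrite walk_vec_conj -[(c *: z) w]/(c * z w).
rewrite -[RHS]/(if prng w == psrc p then F (m w) else 0); case: eqP => [/mP pw|npw].
  rewrite /F (Lop_coord _ pw) walk_vec_conj mulrAC mulrC; congr (_ * _).
  have [wk|wk] := pselect (w = bk k' (plen w)).
    have -> : m w = bk k (plen p + plen w).
      apply: Some_inj; rewrite -pw -back_path_pcomp -pk -/k' -wk; done.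
    by rewrite walk_vec_back {1}wk walk_vec_back exprD.
  rewrite !walk_vec0 ?mulr0// => mk; apply: wk.
  by rewrite mk in pw; have [_] := pcomp_back_path pw.
rewrite walk_vec0 ?mulr0// => wk; apply: npw; rewrite wk prng_back_path pk.
by [].
Qed.

End walk_vectors.

(** * Separation by walk representations *)

Section walk_power_series.
Variables (R : realType) (G : digraph) (K : Type) (tau : K -> K) (lab : K -> edge G).
Hypothesis src_lab : forall k, src (lab k) = rng (lab (tau k)).
Local Notation bk := (back_path src_lab).

Let half_bound : 0 < (1 / 2 : R) <= 1 / 2.
Proof. by rewrite lexx divr_gt0. Qed.

(** [<z, walk_vec k>] is a power series in [t], whose coefficients are the values
    of [z] at the backward walks from [k]; for small [t] its first nonzero term
    dominates the others. *)
Lemma l2dot_walk_neq0 (z : l2 R (dpath G)) k n : z (bk k n) != 0 ->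
  exists t, exists t_bound : 0 < t <= 1 / 2,
    l2dot z (walk_vec src_lab t_bound k) != 0.
Proof.
move=> zn; have exn : exists n, z (bk k n) != 0 by exists n.
case: (ex_minnP exn) => {zn exn}n zn minn.
set b := z (bk k n) in zn; pose z' := z - b *: l2_delta R (bk k n).
have z'0 m : (m <= n)%N -> z' (bk k m) = 0.
  rewrite leq_eqVlt => /orP[/eqP->|ltmn].
    rewrite -[LHS]/(z (bk k n) - b * (bk k n == bk k n)%:R) eqxx mulr1.
    exact: subrr.
  rewrite -[LHS]/(z (bk k m) - b * (bk k m == bk k n)%:R).
  have -> : z (bk k m) = 0.
    by apply/eqP; apply: contraTT ltmn => /minn; rewrite -leqNgt.
  case: eqP => [/(congr1 (@plen G))|_]; last by rewrite mulr0 subr0.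
  by rewrite !plen_back_path => emn; rewrite emn ltnn in ltmn.
set g := walk_vec src_lab half_bound k.
pose M := l2norm z' ^+ 2 + l2norm g ^+ 2.
have M0 : 0 <= M by rewrite addr_ge0 ?sqr_ge0.
have b0 : 0 < cabs b by rewrite cabs_gt0.
(* The remainder is at most [(2 t)^(n + 1) M], since [t^m = (2 t)^m (1 / 2)^m]; the
   first summand of [D] makes this smaller than [t^n |b|], and the second ensures
   [t <= 1 / 2]. *)
pose D := 2 ^+ n.+1 * (M + 1) + 2 * cabs b.
have P0 : 0 < 2 ^+ n.+1 * (M + 1) by rewrite mulr_gt0 ?exprn_gt0 ?ltr_wpDl.
have D0 : 0 < D by rewrite /D addr_gt0// mulr_gt0.
pose t := cabs b / D.
have t0 : 0 < t by rewrite divr_gt0.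
have t1 : t <= 1 / 2.
  rewrite /t ler_pdivrMr// mul1r ler_pdivlMl// /D lerDr; exact: ltW.
have t_bound : 0 < t <= 1 / 2 by rewrite t0 t1.
have tM : 2 ^+ n.+1 * t * M < cabs b.
  rewrite -mulrA mulrCA /t mulrAC ltr_pdivrMr// ltr_pM2l//.
  apply: (@lt_trans _ _ (2 ^+ n.+1 * (M + 1))).
    by rewrite ltr_pM2l ?exprn_gt0 ?ltrDl.
  by rewrite /D ltrDl mulr_gt0.
exists t, t_bound. set y := walk_vec _ _ _.
have -> : l2dot z y = b * (t%:C%C : C R) ^+ n + l2dot z' y.
  rewrite /z' l2dotB l2dotZ l2dot_delta_l walk_vec_conj walk_vec_back.
  by rewrite addrC subrK.
have s0 : 0 <= (2 * t) ^+ n.+1 by rewrite exprn_ge0// mulr_ge0// ltW.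
have small : cabs (l2dot z' y) <= (2 * t) ^+ n.+1 * M.
  rewrite mulrDr; apply: l2dot_le => // u; rewrite -mulrDr.
  have [uk|uk] := pselect (u = bk k (plen u)); last first.
    by rewrite (walk_vec0 _ uk) cabs0 mulr0 mulr_ge0 ?addr_ge0 ?sqr_ge0.
  have [le_un|lt_nu] := leqP (plen u) n.
    by rewrite {1}uk z'0// cabs0 mul0r mulr_ge0 ?addr_ge0 ?sqr_ge0.
  apply: (@le_trans _ _ ((2 * t) ^+ n.+1 * (cabs (z' u) * cabs (g u)))); last first.
    by rewrite ler_wpM2l// mul_le_sqr.
  rewrite mulrCA ler_wpM2l ?cabs_ge0// uk !walk_vec_back !cabsX !cabs_real.
  have h2 : 0 <= 1 / 2 :> R by rewrite divr_ge0.
  rewrite (gtr0_norm t0) (ger0_norm h2) -{1}[t](_ : (2 * t) * (1 / 2) = t); last by field.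
  rewrite exprMn ler_wpM2r ?exprn_ge0// ler_wiXn2l//.
    by rewrite mulr_ge0// ltW.
  by rewrite mulrC -ler_pdivlMr.
apply: contraTneq small => /eqP; rewrite addrC addr_eq0 => /eqP ->.
rewrite cabsN cabsM cabsX cabs_real (gtr0_norm t0) -ltNge exprS exprMn.
have tn : 0 < t ^+ n by rewrite exprn_gt0.
rewrite [cabs b * _]mulrC
  -(_ : t ^+ n * (2 ^+ n.+1 * t * M) = 2 * t * (2 ^+ n * t ^+ n) * M).
  by rewrite ltr_pM2l.
by rewrite exprS; ring.
Qed.

End walk_power_series.

Section walk_representation.
Variables (R : realType) (G : digraph) (K : finType) (tau : K -> K) (lab : K -> edge G).
Hypothesis src_lab : forall k, src (lab k) = rng (lab (tau k)).
Local Notation bk := (back_path src_lab).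
Local Notation L := (@Lop R G).
Local Notation LG := (@free_semigroupoid_algebra R G).
Variable N : nat.
Hypothesis back_edges_inj : forall k l,
  back_edges tau lab k N = back_edges tau lab l N -> k = l.

Section fixed_parameter.
Variable t : R.
Hypothesis t_bound : 0 < t <= 1 / 2.
Local Notation tc := (t%:C%C : C R).
Local Notation y := (walk_vec src_lab t_bound).

Lemma parameter_neq0 : tc != 0.
Proof. by rewrite -cabs_gt0 cabs_real normr_gt0; case/andP: t_bound => /gt_eqF ->. Qed.

(** A walk of length [N] remembers its state, whence these vectors are dual to the
    walk vectors. *)
Definition walk_dual k : l2 R (dpath G) := tc ^- N *: l2_delta R (bk k N).

Lemma walk_dualP k l : l2dot (walk_dual l) (y k) = (l == k)%:R.
Proof.
rewrite l2dotZ l2dot_delta_l walk_vec_conj.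
case: eqP => [->|lk]; first by rewrite walk_vec_back mulVf ?expf_neq0 ?parameter_neq0.
rewrite walk_vec0 ?mulr0//; rewrite plen_back_path => elk; case: lk.
by apply: back_edges_inj; by have := congr1 (@pedges G) elk.
Qed.

Lemma Lop_walk_dual p k l : l2dot (L p (walk_dual l)) (y k) =
  if p == bk k (plen p) then tc ^+ plen p * (l == iter (plen p) tau k)%:R else 0.
Proof. by rewrite l2dot_Lop_walk walk_dualP. Qed.

Lemma walk_coinvariant p : coinvariant walk_dual y (L p).
Proof.
move=> z k; rewrite l2dot_Lop_walk; under eq_bigr do rewrite Lop_walk_dual.
case: eqP => _; last by rewrite big1// => l _; rewrite mul0r.
rewrite (bigD1 (iter (plen p) tau k))//= eqxx mulr1 big1 ?addr0// => l /negbTE ->.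
by rewrite mulr0 mul0r.
Qed.

Hypothesis tau_transitive : forall k l, exists2 n, (N <= n)%N & iter n tau k = l.

(** Along a walk of length at least [N] from [j] to [i], [L p] acts as the matrix
    unit at [(i, j)]: the last [N] edges determine [i], and the length [j]. *)
Lemma walk_irreducible : is_irreducible (compression walk_dual y).
Proof.
apply: compression_irreducible => i j; have [n leNn nij] := tau_transitive i j.
exists (bk i n); exists (tc ^+ n); first by rewrite expf_neq0 ?parameter_neq0.
move=> k l; rewrite Lop_walk_dual plen_back_path.
have -> : (bk i n == bk k n) = (k == i).
  apply/eqP/eqP => [e|->//]; apply/esym/back_edges_inj.
  have := congr1 (@pedges G) e; rewrite /pedges /= -(subnKC leNn) !back_edgesD => /eqP.
  by rewrite eqseq_cat ?size_back_edges// => /andP[_ /eqP].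
by case: eqP => [->|_]; rewrite ?mulr0// nij.
Qed.

End fixed_parameter.

(** The entry at [(k, l)] of the compression of [A], with [l] the state reached
    backwards along [p], is a power series in [t] in which [coef A p] occurs. *)
Lemma walk_separates (A : op R (dpath G)) p k :
  (forall k l, exists2 n, (N <= n)%N & iter n tau k = l) ->
  LG A -> coef A p != 0 -> p = bk k (plen p) ->
  exists n (phi : op R (dpath G) -> 'M[C R]_n),
    [/\ is_representation phi, is_irreducible phi & phi A <> 0].
Proof.
move=> tau_transitive LA Ap pk; set m := plen p in pk.
pose l := iter m tau k; pose z := A (l2_delta R (bk l N)).
have zn : z (bk k (m + N)) != 0.
  by rewrite /z (LG_coef LA (back_path_pcomp src_lab k m N)) -pk.
have [t [t_bound zt]] := l2dot_walk_neq0 zn.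
exists #|K|, (compression (walk_dual t) (walk_vec src_lab t_bound)); split.
- exact/compression_representation/walk_coinvariant.
- exact: walk_irreducible.
move=> /matrixP /(_ (enum_rank k) (enum_rank l)); rewrite !mxE !enum_rankK.
have [linA _] := LG_bounded LA; have A0 := bounded_op0 (LG_bounded LA).
have := linA ((t%:C%C : C R) ^- N) (l2_delta R (bk l N)) 0.
rewrite addr0 A0 addr0 -/(walk_dual t l) => ->.
apply/eqP; rewrite l2dotZ mulf_neq0// invr_neq0 ?expf_neq0//.
exact: parameter_neq0 t_bound.
Qed.

End walk_representation.

(** * Vertices and cycles *)

Section vertex_functional.
Variables (R : realType) (G : digraph).
Local Notation L := (@Lop R G).
Local Notation LG := (@free_semigroupoid_algebra R G).

(** At a path [p] of length [0] the Fourier coefficient is itself multiplicative. *)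
Lemma vertex_separates (A : op R (dpath G)) p : LG A -> coef A p != 0 ->
  plen p = 0%N ->
  exists n (phi : op R (dpath G) -> 'M[C R]_n),
    [/\ is_representation phi, is_irreducible phi & phi A <> 0].
Proof.
move=> LA Ap p0; have pE : vpath (psrc p) = p.
  by apply: dpath_eq => //; apply/esym/size0nil.
have pp : pcomp p p = Some p by rewrite -{2}pE pcomp_vpathr.
pose x (_ : unit) := l2_delta R p.
exists #|{: unit}|, (compression x x); split.
- apply: compression_representation => q z i.
  rewrite (big_pred1 tt) => [|[]//]; rewrite !l2dot_delta.
  have [[w qw]|nq] := pselect (exists w, pcomp q w = Some p); last first.
    by rewrite !Lop_coord0 ?mul0r// => w qw; apply: nq; exists w.
  have wp : w = p.
    have := pcomp_plen qw; rewrite p0 => /esym/eqP; rewrite addn_eq0 => /andP[/eqP w0 _].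
    rewrite (ptake_pcomp qw) w0; apply: dpath_eq => //.
    by rewrite [LHS]/pedges /= take0; apply/esym/size0nil.
  by rewrite !(Lop_coord _ qw) wp /= eqxx mul1r.
- apply: compression_irreducible => i j; exists p.
  exists 1 => [|k l]; first exact: oner_neq0.
  rewrite l2dot_delta (Lop_coord _ pp) /= eqxx.
  by case: k i j l => [] [] [] []; rewrite mulr1.
move=> /matrixP /(_ (enum_rank tt) (enum_rank tt)); rewrite !mxE l2dot_delta.
by apply/eqP; rewrite -[X in A (l2_delta R X)]pE.
Qed.

End vertex_functional.

Lemma iter_rotr1 (T : Type) n (s : seq T) :
  (n <= size s)%N -> iter n (rotr 1) s = rotr n s.
Proof.
elim: n => [|n IHn] ltn; first by rewrite /rotr subn0 rot_size.
rewrite /= IHn ?(ltnW ltn)//; have -> : rotr n s = rot 1 (rotr n.+1 s).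
  by rewrite /rotr -rotS; [congr (rot _ s)|]; lia.
by rewrite rotK.
Qed.

Section cycle.
Variables (G : digraph) (e0 : edge G) (es : seq (edge G)).
Hypothesis es_cycle : cycle (fun e f => rng e == src f) es.
Hypothesis es_neq0 : (0 < size es)%N.

Definition rotations := [seq rot i es | i <- iota 0 (size es)].

Lemma rotationsP c : reflect (exists i, c = rot i es) (c \in rotations).
Proof.
apply: (iffP mapP) => [[i _ ->]|[i ->]]; first by exists i.
have [lti|lei] := ltnP i (size es); first by exists i; rewrite ?mem_iota.
by exists 0%N; rewrite ?mem_iota// rot0 rot_oversize.
Qed.

Lemma rotr1_rotations c : c \in rotations -> rotr 1 c \in rotations.
Proof.
move=> /rotationsP[i ->]; apply/rotationsP.
wlog lei : i / (i <= size es)%N => [hwlog|].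
  have [|/ltnW lei] := leqP i (size es); first exact: hwlog.
  by have := hwlog 0%N isT; rewrite rot0 rot_oversize.
by eexists; rewrite /rotr size_rot rot_add_mod ?leq_subr.
Qed.

(** The states of a walk along the cycle are its distinct rotations: this identifies
    two positions of the cycle exactly when the same edges are read from both,
    also if the cycle repeats a shorter one. *)
Definition state : finType := seq_sub rotations.

Definition previous (k : state) : state := SeqSub (rotr1_rotations (ssvalP k)).

Definition incoming (k : state) : edge G := last e0 (ssval k).

Lemma size_state (k : state) : size (ssval k) = size es.
Proof. by have /rotationsP[i ->] := ssvalP k; rewrite size_rot. Qed.

Lemma src_incoming k : src (incoming k) = rng (incoming (previous k)).
Proof.
rewrite /incoming /=; have := size_state k.
have : cycle (fun e f => rng e == src f) (ssval k).
  by have /rotationsP[i ->] := ssvalP k; rewrite rot_cycle.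
case/lastP: (ssval k) => [|s f] cyc sz; first by move: es_neq0; rewrite -sz.
rewrite last_rcons rotr1_rcons /=; apply/esym/eqP.
by move: cyc; rewrite -(rotr_cycle 1) rotr1_rcons /= rcons_path => /andP[_].
Qed.

(** Stepping back rotates the last edge to the front, so walking back reads the
    state from its end. *)
Lemma back_edges_state (k : state) s s' : ssval k = s ++ s' ->
  back_edges previous incoming k (size s') = s'.
Proof.
elim/last_ind: s' k s => [//|s' f IHs] k s ks.
rewrite size_rcons /= (IHs _ (f :: s)); first by rewrite /incoming ks last_cat last_rcons.
by rewrite /= ks -rcons_cat rotr1_rcons.
Qed.

Lemma back_edges_state_inj (k l : state) :
  back_edges previous incoming k (size es) = back_edges previous incoming l (size es) ->
  k = l.
Proof.
have h (m : state) : back_edges previous incoming m (size es) = ssval m.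
  by rewrite -(size_state m); exact: (@back_edges_state m [::]).
by rewrite !h => kl; exact: val_inj.
Qed.

Lemma iter_previous n (k : state) : ssval (iter n previous k) = iter n (rotr 1) (ssval k).
Proof. by elim: n => //= n ->. Qed.

(** Rotating [i] times undoes the rotation of [k], rotating [size es - j] times
    produces that of [l], and a full turn makes the walk long enough. *)
Lemma previous_transitive (k l : state) :
  exists2 n, (size es <= n)%N & iter n previous k = l.
Proof.
have [/mapP[i i_es ki] /mapP[j j_es lj]] := (ssvalP k, ssvalP l).
rewrite !mem_iota /= add0n in i_es j_es.
have [lei lej] := (ltnW i_es, ltnW j_es).
exists (size es + ((size es - j) + i))%N; first exact: leq_addr.
apply: val_inj; rewrite /= iter_previous ki lj !iterD.
rewrite (iter_rotr1 (n := i)) ?size_rot// rotK.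
rewrite (iter_rotr1 (n := size es - j)) ?leq_subr//.
rewrite iter_rotr1 ?size_rotr//.
rewrite /rotr size_rot subnn rot0 subKn//.
Qed.

Lemma exists_back_path s (p : dpath G) : es = pedges p ++ s -> (0 < plen p)%N ->
  exists k, p = back_path src_incoming k (plen p).
Proof.
move=> es_ps p0; have sp : (s ++ pedges p) \in rotations.
  by apply/rotationsP; exists (plen p); rewrite es_ps rot_size_cat.
exists (SeqSub sp); set u := back_path _ _ _.
have eu : pedges u = pedges p by exact: back_edges_state.
apply: dpath_eq => //; move: p0; rewrite /plen -{1}eu.
have := (dpathP u, dpathP p); rewrite /wf_dpath.
rewrite -/(pedges u) -/(pedges p) -/(psrc u) -/(psrc p).
by rewrite eu; case: (pedges p) => //= f r [/andP[/eqP <- _] /andP[/eqP <- _]].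
Qed.

End cycle.

(** * Components *)

Section components.
Variable G : digraph.
Implicit Types (W : set (vertex G)) (D : set (edge G)).

Local Notation joined := (Relation_Operators.clos_refl_sym_trans (vertex G)).
Local Notation joined_trans := (@Relation_Operators.rst_trans _ _ _ _ _).
Local Notation joined_sym := (@Relation_Operators.rst_sym _ _ _ _).
Local Notation joined_refl := (@Relation_Operators.rst_refl _ _ _).
Local Notation joined_step := (@Relation_Operators.rst_step _ _ _ _).

Definition adjacent D (a b : vertex G) : Prop := exists2 e, D e & src e = a /\ rng e = b.

Definition linked := joined (adjacent setT).

(** A set of vertices closed under adjacency in both directions contains, together
    with a vertex, every chain of edges issued from it. *)
Let sub_linked W D a b :
  (forall e, W (src e) <-> D e) -> (forall e, W (src e) <-> W (rng e)) ->
  linked a b -> (W a <-> W b) /\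
  (W a -> joined (adjacent D) a b).
Proof.
move=> WD Wsr; elim=> {a b}
  [a b [e _ [<- <-]]|a|a b _ [IH1 IH2]|a b c _ [IH1 IH2] _ [IH3 IH4]].
- split=> // We; apply: joined_step; exists e => //; exact/WD.
- by split=> // _; exact: joined_refl.
- split=> [|Wb]; first by rewrite IH1.
  by apply: joined_sym; apply: IH2; exact/IH1.
- split=> [|Wa]; first by rewrite IH1.
  by apply: joined_trans (IH2 Wa) (IH4 _); exact/IH1.
Qed.

Lemma linked_component x :
  is_component [set y | linked x y] [set e | linked x (src e)].
Proof.
have step e : linked (src e) (rng e).
  by apply: joined_step; exists e.
have Wsr e : linked x (src e) <-> linked x (rng e).
  split=> h; apply: joined_trans h _; first exact: step.
  exact/joined_sym/step.
split=> [e /= h|y z /= xy xz|W D sub con xW xD].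
- by split=> //; exact/Wsr.
- have yz : linked y z := joined_trans (joined_sym xy) xz.
  have [_] := @sub_linked [set y | linked x y] [set e | linked x (src e)] y z
    (fun e => iff_refl _) Wsr yz.
  exact.
have WE : W = [set y | linked x y].
  apply/seteqP; split=> // y Wy; have Wx : W x by apply/xW/joined_refl.
  elim: (con _ _ Wx Wy) => {Wy Wx y}.
  - by move=> a b [e _ [<- <-]]; exact: step.
  - by move=> a; exact: joined_refl.
  - by move=> a b _; exact: joined_sym.
  - by move=> a b c _ ab _; exact: joined_trans.
split=> //; apply/seteqP; split=> // e De.
by have [+ _] := sub _ De; rewrite WE.
Qed.

Lemma path_return (p : dpath G) : transitive_in_each_component G ->
  exists q, psrc q = prng p /\ prng q = psrc p.
Proof.
move=> tr; have pl : linked (psrc p) (prng p).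
  case: p => -[a [|e es]]; rewrite /prng /psrc /wf_dpath /= => wp.
    exact: joined_refl.
  have step f : linked (src f) (rng f) by apply: joined_step; exists f.
  have /andP[/eqP <- efs] := wp; apply: joined_trans (step e) _.
  elim: es e efs {wp} => [|f es IHes] e /=; first by move=> _; exact: joined_refl.
  by move=> /andP[/eqP -> /IHes]; exact: joined_trans (step f).
have [q [sq rq _]] :=
  tr _ _ (linked_component (psrc p)) _ _ pl (joined_refl : linked _ _).
by exists q.
Qed.

(** Adding to a connected subgraph an edge whose source lies in it, together with
    the range of that edge, leaves it connected. *)
Lemma component_edge W D e : is_component W D -> W (src e) -> D e.
Proof.
move=> [sub con maxi] We.
pose W' := W `|` [set rng e]; pose D' := D `|` [set e].
have toe y : W' y ->
    joined (adjacent D') (src e) y.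
  move=> [Wy|->]; last by apply: joined_step; exists e => //; right.
  elim: (con _ _ We Wy) => {We Wy y}.
  - by move=> a b [f Df ab]; apply: joined_step; exists f => //; left.
  - by move=> a; exact: joined_refl.
  - by move=> a b _; exact: joined_sym.
  - by move=> a b c _ ab _; exact: joined_trans.
have [||||_ DD] := maxi W' D'; last by rewrite -DD; right.
- by move=> f [/sub[? ?]|->]; split; [left|left|left|right].
- move=> y z W'y W'z; exact: joined_trans
    (joined_sym (toe _ W'y)) (toe _ W'z).
- by move=> y; left.
- by move=> f; left.
Qed.

(** By maximality a component contains every edge that starts in it, hence it is
    never left. *)
Lemma component_path W D (p : dpath G) : is_component W D -> W (psrc p) ->
  forall e, e \in pedges p -> D e.
Proof.
move=> comp; have [sub _ _] := comp; case: p => -[a es] /=; rewrite /psrc /pedges /=.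
case: es => //= f es; rewrite /wf_dpath /= => /andP[/eqP <- fes] Wf.
elim: es f fes Wf => [|g es IHes] f /= => [_|/andP[/eqP fg ges]] Wf e; rewrite inE.
  by move=> /eqP ->; exact: component_edge Wf.
have Df := component_edge comp Wf.
move=> /predU1P[->//|]; apply: IHes => //.
by rewrite -fg; have [] := sub _ Df.
Qed.

(** Within a component any two vertices are joined by a chain of edges, some of
    them travelled backwards; these are replaced by return paths. *)
Lemma transitive_of_edges :
  (forall e : edge G, exists q, psrc q = rng e /\ prng q = src e) ->
  transitive_in_each_component G.
Proof.
move=> back W D comp x y Wx Wy; have [_ con _] := comp.
suff [[p [px py]] _] : (exists p, psrc p = x /\ prng p = y) /\
    (exists p, psrc p = y /\ prng p = x).
  by exists p; split=> // e; apply: component_path comp _ _; rewrite px.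
elim: (con _ _ Wx Wy) => {x y Wx Wy}.
- move=> _ _ [e _ [<- <-]]; split; last exact: back.
  have wf1 : wf_dpath (src e, [:: e]) by rewrite /wf_dpath /= eqxx.
  by exists (DPath wf1).
- by move=> a; split; exists (vpath a).
- by move=> a b _ [].
have trans (a b c : vertex G) : (exists p, psrc p = a /\ prng p = b) ->
    (exists p, psrc p = b /\ prng p = c) -> exists p, psrc p = a /\ prng p = c.
  move=> [p [pa pb]] [q [qb qc]]; have pq : prng p = psrc q by rewrite pb.
  exists (DPath (wf_dpath_cat pq)); split=> //; rewrite -qc.
  by apply: (@pcomp_prng _ q p); apply/pcompP.
move=> a b c _ [ab ba] _ [bc cb].
by split; [exact: trans ab bc|exact: trans cb ba].
Qed.

End components.

(** * Edges lying on no cycle *)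

Section edges_without_return.
Variables (R : realType) (G : digraph) (e : edge G).
Implicit Types (T : op R (dpath G)) (z : l2 R (dpath G)) (p q u w : dpath G).
Local Notation L := (@Lop R G).
Local Notation LG := (@free_semigroupoid_algebra R G).

Fact edge_path_wf : wf_dpath (src e, [:: e]).
Proof. by rewrite /wf_dpath /= eqxx. Qed.
Definition epath : dpath G := DPath edge_path_wf.

Let reach (a : vertex G) : Prop := exists q, psrc q = rng e /\ prng q = a.

Let reach_pcomp p w u : pcomp p w = Some u -> reach (prng w) -> reach (prng u).
Proof.
move=> pw [q [qe qw]]; have /pcompP[wp _ _] := pw.
have qp : prng q = psrc p by rewrite qw.
exists (DPath (wf_dpath_cat qp)); split=> //.
rewrite (pcomp_prng pw); apply: (@pcomp_prng _ p q); exact/pcompP.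
Qed.

Let reachable z : Prop := forall w, ~ reach (prng w) -> z w = 0.

(** The final vertex of [p w] is reachable as soon as that of [w] is, so the
    generators preserve the condition. *)
Lemma LG_reachable T z : LG T -> reachable z -> reachable (T z).
Proof.
move=> LT rz w nw.
pose J := ({z | reachable z} * {w | ~ reach (prng w)})%type.
pose F (j : J) (A : wot R (dpath G)) : C R := A (sval j.1) (sval j.2).
have FE A : (forall j, F j A = 0) <-> (forall z, reachable z -> reachable (A z)).
  split=> [FA {}z {}rz {}w {}nw|rA [[{}z {}rz] [{}w {}nw]]]; last exact: rA.
  exact: (FA (exist _ z rz, exist _ w nw)).
move: z rz w nw; apply/FE; apply: LG_ind LT.
- by move=> j; exact: wot_continuous_coord.
- split=> [|a A B /FE hA /FE hB|A B /FE hA /FE hB]; apply/FE => z rz w nw.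
  + by [].
  + rewrite -[LHS]/(a * A z w + B z w) (hA _ rz _ nw) (hB _ rz _ nw).
    by rewrite mulr0 addr0.
  + exact: hA (hB _ rz) _ nw.
- move=> p; apply/FE => z rz u nu.
  have [[w pw]|np] := pselect (exists w, pcomp p w = Some u); last first.
    by rewrite Lop_coord0// => w pw; apply: np; exists w.
  by rewrite (Lop_coord _ pw) rz// => /(reach_pcomp pw).
Qed.

(** The range of [L epath] consists of reachable vectors, which [T] preserves, while
    [L epath] only sees the paths that end at [src e]. *)
Lemma Lop_edge_sandwich T : LG T -> ~ reach (src e) -> L epath \o (T \o L epath) = 0.
Proof.
move=> LT ne; apply/funext => z; apply: val_inj; apply/funext => u.
rewrite -[RHS]/(0 : C R) -[LHS]/(L epath (T (L epath z)) u).
have [[w ew]|nu] := pselect (exists w, pcomp epath w = Some u); last first.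
  by rewrite Lop_coord0// => w ew; apply: nu; exists w.
rewrite (Lop_coord _ ew); have /pcompP[we _ _] := ew.
apply: LG_reachable => //; last by rewrite we.
move=> v nv; have [[w' ew']|nv'] := pselect (exists w', pcomp epath w' = Some v).
  by case: nv; rewrite (pcomp_prng ew'); exists (vpath (rng e)).
by rewrite Lop_coord0// => w' ew'; apply: nv'; exists w'.
Qed.

Lemma Lop_edge_neq0 : L epath <> 0.
Proof.
move=> /(congr1 (fun T => T (l2_delta R (vpath (src e))) epath)).
rewrite (Lop_coord _ (pcomp_vpathr epath)) /= eqxx => /eqP.
by rewrite oner_eq0.
Qed.

(** For the matrix unit [M] at [(j, i)], the entry of [X M X] at [(i, j)] is the
    square of [X i j]. *)
Lemma mx_sandwich0 n (X : 'M[C R]_n) : (forall M, X *m M *m X = 0) -> X = 0.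
Proof.
move=> XX; apply/matrixP => i j; have /matrixP/(_ i j) := XX (delta_mx j i).
rewrite -(mul_delta_mx (0 : 'I_1)) mulmxA -colE -mulmxA -rowE.
rewrite !mxE big_ord1 !mxE => /eqP.
by rewrite mulf_eq0 orbb => /eqP.
Qed.

Lemma irreducible_kills_edge n (phi : op R (dpath G) -> 'M[C R]_n) :
  is_representation phi -> is_irreducible phi -> ~ reach (src e) ->
  phi (L epath) = 0.
Proof.
move=> [phi_lin phi_mul _] phi_irr ne; have LL : LG (L epath).
  exact: alg_LG (Lop_alg _).
have L0 : LG 0 by apply: alg_LG; have [] := generated_subalgebra (range L).
apply: mx_sandwich0 => M; have [T LT <-] : (phi @` LG) M by rewrite phi_irr.
have LTL := LG_comp_Lop epath LT.
rewrite -mulmxA -!phi_mul// Lop_edge_sandwich//.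
by have := phi_lin (-1) _ _ L0 L0; rewrite scaler0 addr0 scaleN1r addNr.
Qed.

End edges_without_return.

Theorem theorem4p4 (R : realType) (G : digraph) :
  (forall A : op R (dpath G), free_semigroupoid_algebra A -> A <> 0 ->
     exists (n : nat) (phi : op R (dpath G) -> 'M[C R]_n),
       [/\ is_representation phi, is_irreducible phi & phi A <> 0])
  <-> transitive_in_each_component G.
Proof.
split=> [sep|tr A LA A0].
  apply: transitive_of_edges => e; apply: contrapT => ne.
  have [||n [phi [rep irr]]] := sep (@Lop R G (epath e)).
  - exact: alg_LG (Lop_alg _).
  - exact: Lop_edge_neq0.
  - by apply; exact: irreducible_kills_edge.
have [p Ap] := LG_coef_neq0 LA A0.
have [p0|p_gt0] := posnP (plen p); first exact: vertex_separates LA Ap p0.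
have [q [qp pq]] := path_return p tr.
case pE : (pedges p) (p_gt0) => [|e es]; first by rewrite /plen pE.
move=> _; pose c := pedges p ++ pedges q.
(* Appending the first edge again to the closed path [q p] gives a path, which is
   the cyclicity of its edges. *)
have c_cycle : cycle (fun e f => rng e == src f) c.
  have c_wf := wf_dpath_cat (esym qp).
  have e_src : src e = psrc p.
    by have := dpathP p; rewrite /wf_dpath -/(pedges p) pE => /andP[/eqP].
  have c_e : prng (DPath c_wf) = psrc (epath e).
    rewrite (@pcomp_prng _ q p); first by rewrite pq -e_src.
    by apply/pcompP; rewrite qp.
  have : wf_dpath (psrc p, c ++ [:: e]) := wf_dpath_cat c_e.
  by rewrite /wf_dpath /c pE /= cats1 => /andP[].
have c_gt0 : (0 < size c)%N by rewrite size_cat (leq_trans p_gt0)// leq_addr.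
have [k pk] := exists_back_path e c_cycle c_gt0 (erefl c) p_gt0.
exact: (@walk_separates R G _ _ _ (src_incoming e c_cycle c_gt0) _
  (@back_edges_state_inj _ e c c_gt0) A p k (@previous_transitive _ c c_gt0) LA Ap pk).
Qed.
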